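(* Let $\mathfrak{g}$ be a finite-dimensional real Lie algebra, $I\subseteq\mathfrak{g}$ a Lie ideal with annihilator $I^0\subseteq\mathfrak{g}^*$, and let $H\in\bigwedge^3I^0$ be a Chevalley--Eilenberg closed form, so that it descends to a closed $\tilde H\in\bigwedge^3(\mathfrak{g}/I)^*$. Consider the Dirac structure $L=I+I^0$ in $(\mathfrak{g}\oplus\mathfrak{g}^* )_H$. If the class $[\tilde H]$ in the Chevalley--Eilenberg cohomology $H^3(\mathfrak{g}/I)$ is nonzero, then the obstruction class satisfies $N^L\neq0$, and so $L$ admits no Dirac complement.
   Context: $(\mathfrak{g}\oplus\mathfrak{g}^* )_H$ denotes the vector space $\mathfrak{g}\oplus\mathfrak{g}^*$ with pairing $\langle A_1+\alpha_1,A_2+\alpha_2\rangle=\alpha_1(A_2)+\alpha_2(A_1)$ and bracket $[A_1+\alpha,A_2+\beta]=[A_1,A_2]+\mathcal{L}_{A_1}\beta-\mathcal{L}_{A_2}\alpha+\iota_{A_2}\iota_{A_1}H$, where $\mathcal{L}_A\beta=-(\mathrm{ad}_A)^*\beta$. It is a quadratic Lie algebra, i.e. a Courant algebroid over a point (with zero anchor). Let $E$ be a quadratic Lie algebra with pairing of signature $(n,n)$. A subspace $L\subseteq E$ is lagrangian if $L=L^\perp$, and a Dirac structure is a lagrangian subalgebra. A lagrangian (resp. Dirac) complement of $L$ is a lagrangian subspace (resp. Dirac structure) $M$ with $L\oplus M=E$; lagrangian complements always exist, and the pairing gives $L\cong M^*$. Obstruction class. Let $L$ be a Dirac structure. The Lie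 bracket of $L$ extends to $\bigwedge^\bullet L$ as the Schouten bracket $[l_1\wedge\dots\wedge l_p,l'_1\wedge\dots\wedge l'_q]=\sum_{i,j}(-1)^{i+j}[l_i,l'_j]\wedge l_1\wedge\dots\widehat{l_i}\dots\wedge l_p\wedge l'_1\wedge\dots\widehat{l'_j}\dots\wedge l'_q$ (zero if one argument is in $\bigwedge^0L=\mathbb{R}$). Let $\mathfrak{a}(L)=\bigwedge^\bullet L$ (with degree shifted by one so that the bracket has degree $0$) and $\mathfrak{a}_{\mathrm{ab}}(L)=\mathfrak{a}(L)/[\mathfrak{a}(L),\mathfrak{a}(L)]$, the quotient by the span of all brackets; $\underline{\alpha}$ denotes the class of $\alpha$. For a lagrangian complement $M$, let $d_M$ be the degree $+1$ graded derivation of $\bigwedge^\bullet L\cong\bigwedge^\bullet M^*$ with $(d_Ml)(m_1,m_2)=-\langle l,[m_1,m_2]\rangle$ for $l\in L$, and let $N_M\in\bigwedge^3M^*\cong\bigwedge^3L$ be $N_M(m_1,m_2,m_3)=\langle[m_1,m_2],m_3\rangle$. Then $d_M$ descends to a differential $d$ on $\mathfrak{a}_{\mathrm{ab}}(L)$ independent of $M$, with cohomology $H^k(\mathfrak{a}_{\mathrm{ab}}(L))$ ($k$ the exterior degree), and the cohomology class of $\underline{N_M}$ is independent of $M$. The obstruction class is $N^L=[\underline{N_M}]\in H^3(\mathfrak{a}_{\mathrm{ab}}(L))$. *)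

(* Defs.v *)
From HB Require Import structures.
From mathcomp Require Import all_boot all_order all_algebra all_field.
From mathcomp Require Import generic_quotient ring_quotient.

Set Implicit Arguments.
Unset Strict Implicit.
Unset Printing Implicit Defensive.

Import GRing.Theory.
Local Open Scope ring_scope.

(** * Quotient vector spaces *)

Section QuotientSpace.
Variables (F : fieldType) (V : vectType F) (U : {vspace V}).

(* The cosets x + U. *)
Definition quotv : Type := Quotient.quot (pred_of_vspace U).

HB.instance Definition _ := GRing.Zmodule.on quotv.

Definition qpi : V -> quotv := \pi_(Quotient.quot (pred_of_vspace U))%qT.
Definition qrepr : quotv -> V := fun q => repr q.

Lemma qreprK : cancel qrepr qpi.
Proof. exact: reprK. Qed.

Lemma qpi_eq (x y : V) : (qpi x == qpi y) = (x - y \in U).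
Proof. by rewrite /qpi -(Quotient.idealrBE (pred_of_vspace U)). Qed.

Lemma qpiD (x y : V) : qpi (x + y) = qpi x + qpi y.
Proof. by rewrite /qpi Quotient.pi_add. Qed.

Definition qscale (a : F) (q : quotv) : quotv := qpi (a *: qrepr q).

Lemma qpiZ a x : qpi (a *: x) = qscale a (qpi x).
Proof.
apply/eqP; rewrite qpi_eq -scalerBr memvZ // -qpi_eq.
by rewrite qreprK.
Qed.

Fact qscaleA a b q : qscale a (qscale b q) = qscale (a * b) q.
Proof. by rewrite -[q]qreprK -!qpiZ scalerA. Qed.
Fact qscale1 : left_id 1 qscale.
Proof. by move=> q; rewrite -[q]qreprK -!qpiZ scale1r. Qed.
Fact qscaleDr : right_distributive qscale +%R.
Proof.
by move=> a q r; rewrite -[q]qreprK -[r]qreprK -qpiD -!qpiZ scalerDr qpiD.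
Qed.
Fact qscaleDl q : {morph qscale^~ q : a b / a + b}.
Proof. by move=> a b; rewrite -[q]qreprK -!qpiZ scalerDl qpiD. Qed.

HB.instance Definition _ := GRing.Zmodule_isLmodule.Build F quotv
  qscaleA qscale1 qscaleDr qscaleDl.

Fact qpi_linear : linear qpi.
Proof. by move=> a x y; rewrite qpiD qpiZ. Qed.
HB.instance Definition _ := GRing.isLinear.Build F V quotv _ qpi qpi_linear.

Fact quotv_vect_iso : Vector.axiom (\dim (U^C)%VS) quotv.
Proof.
pose n := \dim (U^C)%VS; pose e : n.-tuple V := vbasis (U^C)%VS.
pose r : 'End(V) := (\1 - projv U)%VF.
have rE x : r x = x - projv U x by rewrite add_lfunE opp_lfunE id_lfunE.
have rU x : x \in U -> r x = 0 by move=> Ux; rewrite rE projv_id ?subrr.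
pose f (q : quotv) : 'rV[F]_n := \row_i coord e i (r (qrepr q)).
have fpi x : f (qpi x) = \row_i coord e i (r x).
  apply/rowP=> i; rewrite !mxE; congr (coord _ _ _); apply/subr0_eq.
  by rewrite -linearB /= rU // -qpi_eq qreprK.
exists f.
  move=> a q s; rewrite -[q]qreprK -[s]qreprK -qpi_linear !fpi.
  by apply/rowP=> i; rewrite !mxE !linearP.
exists (fun w : 'rV[F]_n => qpi (\sum_i w 0 i *: e`_i)) => [q | w].
  rewrite -[q]qreprK fpi; apply/eqP; rewrite qpi_eq.
  under eq_bigr => i _ do rewrite mxE.
  rewrite -coord_vbasis ?rE ?memv_projC //.
  by rewrite addrAC subrr add0r memvN memv_proj.
rewrite fpi; apply/rowP=> i; rewrite !mxE.
set x := \sum_i _; have Cx : x \in (U^C)%VS.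
  by apply: memv_suml => j _; rewrite memvZ // vbasis_mem // mem_nth ?size_tuple.
have -> : r x = x.
  by rewrite rE; have /eqP-> : projv U x == 0; rewrite ?subr0 // -memv_ker lker_proj.
by rewrite coord_sum_free // (basis_free (vbasisP _)).
Qed.
HB.instance Definition _ := Lmodule_hasFinDim.Build F quotv quotv_vect_iso.

Definition qproj : 'Hom(V, quotv) := linfun qpi.

Lemma lker_qproj : lker qproj = U.
Proof.
apply/vspaceP=> x; rewrite memv_ker lfunE /=.
by rewrite -(linear0 qpi) qpi_eq subr0.
Qed.

Lemma limg_qproj : limg qproj = fullv.
Proof.
apply/vspaceP=> q; rewrite memvf; apply/memv_imgP.
by exists (qrepr q); rewrite ?memvf // lfunE /= qreprK.
Qed.

(* The endomorphism induced by f, provided that f preserves U (quot_endE). *)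
Definition quot_end (f : 'End(V)) : 'End(quotv) := (qproj \o f \o qproj^-1)%VF.

Lemma quot_endE f : (f @: U <= U)%VS ->
  forall x, quot_end f (qproj x) = qproj (f x).
Proof.
move=> fU x; rewrite !comp_lfunE; apply/eqP; rewrite -subr_eq0 -!linearB /=.
rewrite -memv_ker lker_qproj; apply: (subvP fU); apply: memv_img.
rewrite -lker_qproj memv_ker linearB /= subr_eq0.
by rewrite limg_lfunVK // limg_qproj memvf.
Qed.

End QuotientSpace.

(** * The exterior algebra of a vector space *)

Section ExteriorAlgebra.
Variables (F : fieldType) (V : vectType F).
Local Notation n := (\dim {:V}).
Local Notation e := (vbasis {:V}).

(* An element is its family of coordinates in the basis of blades            *)
(* e_S = e_{s_1} ^ ... ^ e_{s_k}, S = {s_1 < ... < s_k}, where (e_i) is the  *)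
(* library's chosen basis of V.                                              *)
Definition exterior : Type := {ffun {set 'I_n} -> F^o}.

HB.instance Definition _ := Vector.on exterior.

Definition ext_coord (x : exterior) (S : {set 'I_n}) : F :=
  (x : {ffun {set 'I_n} -> F^o}) S.
Definition ext_blade (S : {set 'I_n}) : exterior := [ffun T => (T == S)%:R].

Definition ext_inv (S T : {set 'I_n}) : nat :=
  #|[set p : 'I_n * 'I_n in setX S T | (p.2 < p.1)%N]|.

Definition ext_mul_blade (S T : {set 'I_n}) : exterior :=
  if [disjoint S & T] then (-1) ^+ ext_inv S T *: ext_blade (S :|: T) else 0.

Definition ext_mul (x y : exterior) : exterior :=
  \sum_S \sum_T (ext_coord x S * ext_coord y T) *: ext_mul_blade S T.

Lemma ext_coordD x y S : ext_coord (x + y) S = ext_coord x S + ext_coord y S.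
Proof. by rewrite /ext_coord ffunE. Qed.
Lemma ext_coordZ a x S : ext_coord (a *: x) S = a * ext_coord x S.
Proof. by rewrite /ext_coord ffunE. Qed.

Lemma ext_coord_sum I r (P : pred I) (f : I -> exterior) S :
  ext_coord (\sum_(i <- r | P i) f i) S = \sum_(i <- r | P i) ext_coord (f i) S.
Proof.
elim/big_rec2: _ => [|i a x _ <-]; first by rewrite /ext_coord ffunE.
by rewrite ext_coordD.
Qed.

Lemma ext_coord_blade S T : ext_coord (ext_blade S) T = (T == S)%:R.
Proof. by rewrite /ext_coord ffunE. Qed.

Lemma ext_blade_sum (x : exterior) : x = \sum_S ext_coord x S *: ext_blade S.
Proof.
apply/ffunP=> T; rewrite -[LHS]/(ext_coord x T) -[RHS]/(ext_coord _ T).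
rewrite ext_coord_sum (bigD1 T) //= big1 => [|S neST].
  by rewrite ext_coordZ ext_coord_blade eqxx mulr1 addr0.
by rewrite ext_coordZ ext_coord_blade eq_sym (negPf neST) mulr0.
Qed.

(* Two linear maps out of the exterior algebra agreeing on blades are equal. *)
Lemma ext_blade_ind (W : lmodType F) (f g : exterior -> W) :
    linear f -> linear g ->
  (forall S, f (ext_blade S) = g (ext_blade S)) -> f =1 g.
Proof.
move=> lf lg fg x.
pose f' : {linear exterior -> W} := HB.pack f (GRing.isLinear.Build _ _ _ _ f lf).
pose g' : {linear exterior -> W} := HB.pack g (GRing.isLinear.Build _ _ _ _ g lg).
rewrite [x]ext_blade_sum -[f _]/(f' _) -[g _]/(g' _) !linear_sum.
by apply: eq_bigr => S _; rewrite !linearZ; congr (_ *: _); exact: fg.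
Qed.

Fact ext_mul_linl y : linear (ext_mul^~ y).
Proof.
move=> a x x'; rewrite /ext_mul scaler_sumr -big_split; apply: eq_bigr => S _ /=.
rewrite scaler_sumr -big_split; apply: eq_bigr => T _ /=.
by rewrite ext_coordD ext_coordZ scalerA -scalerDl mulrDl mulrA.
Qed.
Fact ext_mul_linr x : linear (ext_mul x).
Proof.
move=> a y y'; rewrite /ext_mul scaler_sumr -big_split; apply: eq_bigr => S _ /=.
rewrite scaler_sumr -big_split; apply: eq_bigr => T _ /=.
by rewrite ext_coordD ext_coordZ scalerA -scalerDl mulrDr mulrCA.
Qed.

Lemma ext_mul_bladeE S T : ext_mul (ext_blade S) (ext_blade T) = ext_mul_blade S T.
Proof.
rewrite /ext_mul (bigD1 S) //= [X in _ + X]big1 ?addr0 => [|S' neS]; last first.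
  by apply: big1 => T' _; rewrite ext_coord_blade (negPf neS) mul0r scale0r.
rewrite (bigD1 T) //= [X in _ + X]big1 ?addr0 => [|T' neT].
  by rewrite !ext_coord_blade !eqxx mulr1 scale1r.
by rewrite [ext_coord _ T']ext_coord_blade (negPf neT) mulr0 scale0r.
Qed.

Lemma ext_invUl (S T U : {set 'I_n}) : [disjoint S & T] ->
  ext_inv (S :|: T) U = (ext_inv S U + ext_inv T U)%N.
Proof.
move=> dST; rewrite /ext_inv -cardsUI [X in (_ + X)%N]eq_card0 ?addn0.
  by apply: eq_card => -[i j]; rewrite !inE /=;
     case: (i \in S); case: (i \in T); case: (j \in U); case: (j < i)%N.
move=> [i j]; rewrite !inE /=; apply/negP => /andP[/andP[/andP[Si _] _]].
by move=> /andP[/andP[Ti _] _]; move/pred0P/(_ i): dST; rewrite /= Si Ti.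
Qed.

Lemma ext_invUr (S T U : {set 'I_n}) : [disjoint T & U] ->
  ext_inv S (T :|: U) = (ext_inv S T + ext_inv S U)%N.
Proof.
move=> dTU; rewrite /ext_inv -cardsUI [X in (_ + X)%N]eq_card0 ?addn0.
  by apply: eq_card => -[i j]; rewrite !inE /=;
     case: (i \in S); case: (j \in T); case: (j \in U); case: (j < i)%N.
move=> [i j]; rewrite !inE /=; apply/negP => /andP[/andP[/andP[_ Tj] _]].
by move=> /andP[/andP[_ Uj] _]; move/pred0P/(_ j): dTU; rewrite /= Tj Uj.
Qed.

Lemma ext_inv0l (S : {set 'I_n}) : ext_inv set0 S = 0%N.
Proof. by apply/eqP; rewrite cards_eq0; apply/eqP/setP=> p; rewrite !inE. Qed.
Lemma ext_inv0r (S : {set 'I_n}) : ext_inv S set0 = 0%N.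
Proof. by apply/eqP; rewrite cards_eq0; apply/eqP/setP=> p; rewrite !inE andbF. Qed.

Fact ext_mulA : associative ext_mul.
Proof.
move=> x y z.
have comp (f g : exterior -> exterior) : linear f -> linear g -> linear (f \o g).
  by move=> lf lg a u v; rewrite /= lg lf.
move: x; apply: ext_blade_ind => [||S]; first exact: ext_mul_linl.
  exact: comp (ext_mul_linl z) (ext_mul_linl y).
move: y; apply: ext_blade_ind => [||T].
- exact: comp (ext_mul_linr _) (ext_mul_linl z).
- exact: comp (ext_mul_linl z) (ext_mul_linr _).
move: z; apply: ext_blade_ind => [||U].
- exact: comp (ext_mul_linr _) (ext_mul_linr _).
- exact: ext_mul_linr.
have mul0 u : ext_mul 0 u = 0.
  by have := ext_mul_linl u (-1) 0 0; rewrite scaler0 addr0 scaleN1r addNr.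
have mulr0 u : ext_mul u 0 = 0.
  by have := ext_mul_linr u (-1) 0 0; rewrite scaler0 addr0 scaleN1r addNr.
have mulZ a u v : ext_mul (a *: u) v = a *: ext_mul u v.
  by have := ext_mul_linl v a u 0; rewrite !addr0 mul0 addr0.
have mulZr a u v : ext_mul u (a *: v) = a *: ext_mul u v.
  by have := ext_mul_linr u a v 0; rewrite !addr0 mulr0 addr0.
rewrite !ext_mul_bladeE /ext_mul_blade.
have disjU (A B C : {set 'I_n}) :
    [disjoint A :|: B & C] = [disjoint A & C] && [disjoint B & C].
  by rewrite -!setI_eq0 setIUl setU_eq0.
have disjUr (A B C : {set 'I_n}) :
    [disjoint A & B :|: C] = [disjoint A & B] && [disjoint A & C].
  by rewrite -!setI_eq0 setIUr setU_eq0.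
have [dST|dST] := boolP [disjoint S & T]; have [dTU|dTU] := boolP [disjoint T & U];
  rewrite ?mul0 ?mulr0 ?mulZ ?mulZr ?ext_mul_bladeE /ext_mul_blade //.
- rewrite disjU dTU disjUr dST andbT /=.
  case: ifP => [dSU|_]; last by rewrite !scaler0.
  by rewrite !scalerA -!exprD ext_invUl // ext_invUr // setUA addnCA
    (addnC (ext_inv T U)).
- by rewrite disjU (negPf dTU) andbF scaler0.
- by rewrite disjUr (negPf dST) scaler0.
Qed.

Fact ext_mul1l : left_id (ext_blade set0) ext_mul.
Proof.
apply: ext_blade_ind => [||S]; first exact: ext_mul_linr.
  by [].
by rewrite ext_mul_bladeE /ext_mul_blade -setI_eq0 set0I eqxx ext_inv0l scale1r set0U.
Qed.

Fact ext_mul1r : right_id (ext_blade set0) ext_mul.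
Proof.
apply: ext_blade_ind => [||S]; first exact: ext_mul_linl.
  by [].
by rewrite ext_mul_bladeE /ext_mul_blade -setI_eq0 setI0 eqxx ext_inv0r scale1r setU0.
Qed.

Fact ext_mulDl : left_distributive ext_mul +%R.
Proof. by move=> x y z; have := ext_mul_linl z 1 x y; rewrite !scale1r. Qed.
Fact ext_mulDr : right_distributive ext_mul +%R.
Proof. by move=> x y z; have := ext_mul_linr x 1 y z; rewrite !scale1r. Qed.

Fact ext_1_neq0 : ext_blade set0 != 0.
Proof.
apply/eqP=> /(congr1 (ext_coord^~ set0)) /eqP.
by rewrite ext_coord_blade eqxx /ext_coord ffunE oner_eq0.
Qed.

HB.instance Definition _ := GRing.Zmodule_isNzRing.Build exterior
  ext_mulA ext_mul1l ext_mul1r ext_mulDl ext_mulDr ext_1_neq0.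

Fact ext_scaleAl (a : F) (x y : exterior) : a *: (x * y) = (a *: x) * y.
Proof.
have y0 : ext_mul 0 y = 0 := mul0r (y : exterior).
by have := ext_mul_linl y a x 0; rewrite y0 !addr0.
Qed.
Fact ext_scaleAr (a : F) (x y : exterior) : a *: (x * y) = x * (a *: y).
Proof.
have x0 : ext_mul x 0 = 0 := mulr0 (x : exterior).
by have := ext_mul_linr x a y 0; rewrite x0 !addr0.
Qed.
HB.instance Definition _ := GRing.Lmodule_isLalgebra.Build F exterior ext_scaleAl.
HB.instance Definition _ := GRing.Lalgebra_isAlgebra.Build F exterior ext_scaleAr.
HB.instance Definition _ := Algebra_isFalgebra.Build F exterior.

Definition ext_vec (v : V) : exterior :=
  \sum_(i < n) coord e i v *: ext_blade [set i].

Fact ext_vec_linear : linear ext_vec.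
Proof.
move=> a u v; rewrite /ext_vec scaler_sumr -big_split; apply: eq_bigr => i _ /=.
by rewrite linearP scalerDl scalerA.
Qed.
HB.instance Definition _ :=
  GRing.isLinear.Build F V exterior _ ext_vec ext_vec_linear.

Lemma ext_vec_basis (i : 'I_n) : ext_vec e`_i = ext_blade [set i].
Proof.
have fr : free e := basis_free (vbasisP _).
rewrite /ext_vec (bigD1 i) //= big1 ?addr0 => [|j neji].
  by rewrite (coord_free _ _ fr) eqxx scale1r.
by rewrite (coord_free _ _ fr) eq_sym (negPf neji) scale0r.
Qed.

Lemma ext_bladeM S T : ext_blade S * ext_blade T = ext_mul_blade S T.
Proof. exact: ext_mul_bladeE. Qed.

Lemma ext_inv1 (i j : 'I_n) : ext_inv [set i] [set j] = (j < i)%N.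
Proof.
rewrite /ext_inv; case: ltnP => ij /=.
  apply/eqP/cards1P; exists (i, j); apply/setP=> -[a b]; rewrite !inE /= xpair_eqE.
  by case: eqP => //= ->; case: eqP => //= ->.
apply/eqP; rewrite cards_eq0; apply/eqP/setP=> -[a b]; rewrite !inE /=.
by case: eqP => //= ->; case: eqP => //= ->; rewrite ltnNge ij.
Qed.

Lemma ext_blade1_sqr (i : 'I_n) : ext_blade [set i] * ext_blade [set i] = 0.
Proof. by rewrite ext_bladeM /ext_mul_blade disjoints1 inE eqxx. Qed.

Lemma ext_blade1C (i j : 'I_n) :
  ext_blade [set i] * ext_blade [set j] + ext_blade [set j] * ext_blade [set i] = 0.
Proof.
have [<-|neij] := eqVneq i j; first by rewrite ext_blade1_sqr addr0.
rewrite !ext_bladeM /ext_mul_blade !disjoints1 !inE neij eq_sym neij /=.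
rewrite !ext_inv1 [[set j] :|: _]setUC -scalerDl; case: ltngtP neij => //= [_ _|_ _|].
- by rewrite ?expr0 ?expr1 ?subrr ?addNr ?scale0r.
- by rewrite ?expr0 ?expr1 ?subrr ?addNr ?scale0r.
- by move/val_inj ->; rewrite eqxx.
Qed.

Lemma ext_vec_sqr v : ext_vec v * ext_vec v = 0.
Proof.
rewrite /ext_vec; elim: (index_enum _) => [|i r IHr]; first by rewrite big_nil mul0r.
rewrite big_cons mulrDl !mulrDr {}IHr addr0.
rewrite -scalerAl -scalerAr ext_blade1_sqr !scaler0 add0r.
rewrite mulr_sumr mulr_suml -big_split big1 //= => j _.
rewrite -!scalerAl -!scalerAr !scalerA [coord e j v * _]mulrC -scalerDr.
by rewrite ext_blade1C scaler0.
Qed.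

Definition ext_wedge (s : seq V) : exterior := \prod_(v <- s) ext_vec v.

(* The vectors e_{s_1}, ..., e_{s_k} for S = {s_1 < ... < s_k}. *)
Definition ext_basis (S : {set 'I_n}) : seq V := [seq e`_(i : 'I_n) | i <- enum S].

Lemma ext_wedge_basis S : ext_wedge (ext_basis S) = ext_blade S.
Proof.
rewrite /ext_wedge big_map.
have : sorted (relpre (@nat_of_ord n) ltn) (enum S).
  rewrite /enum_mem -enumT sorted_filter //; first by move=> ? ? ?; exact: ltn_trans.
  by rewrite -sorted_map val_enum_ord iota_ltn_sorted.
rewrite -[in RHS](set_enum S) => sS.
elim: (enum S) sS => [|i s IHs] sS.
  by rewrite big_nil; congr ext_blade; apply/setP=> j; rewrite !inE.
rewrite big_cons IHs; last exact: path_sorted sS.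
have gti j : j \in s -> (i < j)%N.
  by move: sS => /= /(order_path_min _) /allP; apply=> ? ? ?; exact: ltn_trans.
rewrite ext_vec_basis ext_bladeM /ext_mul_blade set_cons disjoints1 inE.
have -> : i \notin s by apply/negP=> /gti; rewrite ltnn.
have -> : ext_inv [set i] [set j in s] = 0%N.
  apply/eqP; rewrite cards_eq0; apply/eqP/setP=> -[a b]; rewrite !inE /=.
  by apply/negP=> /andP[/andP[/eqP-> /gti ib]]; rewrite ltnNge ltnW.
by rewrite scale1r.
Qed.

(* The k-th exterior power of U. *)
Definition ext_pow (U : {vspace V}) (k : nat) : {vspace exterior} :=
  ((linfun ext_vec @: U) ^+ k)%VS.

End ExteriorAlgebra.

(** * Linear maps and exterior algebras *)

Section ExteriorMaps.
Variables (F : fieldType) (V W : vectType F).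

(* The algebra morphism induced by f. *)
Definition ext_map (f : 'Hom(V, W)) : 'Hom(exterior V, exterior W) :=
  linfun (fun x : exterior V =>
    \sum_S ext_coord x S *: ext_wedge [seq f v | v <- ext_basis S]).

(* The inverse of ext_vec on degree one elements. *)
Definition ext_degree1 (x : exterior V) : V :=
  \sum_i ext_coord x [set i] *: (vbasis {:V})`_i.

(* The odd derivation D extending delta : V -> exterior V, where delta takes *)
(* values in even degree: D (v ^ x) = delta v ^ x - v ^ D x.                 *)
Fixpoint odd_deriv_wedge (delta : V -> exterior V) (s : seq V) : exterior V :=
  if s is v :: s' then
    delta v * ext_wedge s' - ext_vec v * odd_deriv_wedge delta s'
  else 0.

Definition odd_deriv (delta : V -> exterior V) : 'End(exterior V) :=
  linfun (fun x : exterior V =>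
    \sum_S ext_coord x S *: odd_deriv_wedge delta (ext_basis S)).

End ExteriorMaps.

(** * Forms on a space W in duality with V, as multivectors of V *)

Section Duality.
Variables (F : fieldType) (V W : vectType F).

Definition curry_hom (p : V -> W -> F) : 'Hom(V, 'Hom(W, F^o)) :=
  linfun (fun v => linfun (p v : W -> F^o)).

Lemma curry_homE (p : V -> W -> F) :
    (forall v, scalar (p v)) -> (forall w, scalar (p^~ w)) ->
  forall v w, curry_hom p v w = p v w.
Proof.
move=> pr pl v w.
pose pv u : {linear W -> F^o} := HB.pack (p u : W -> F^o)
  (GRing.isLinear.Build _ _ F^o _ _ (pr u)).
have pvE u x : linfun (p u : W -> F^o) x = p u x := lfunE (pv u) x.
have lp : linear (fun v => linfun (p v : W -> F^o)).
  by move=> a u u'; apply/lfunP=> x; rewrite add_lfunE scale_lfunE !pvE pl.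
pose q : {linear V -> 'Hom(W, F^o)} := HB.pack (fun v => linfun (p v : W -> F^o))
  (GRing.isLinear.Build _ _ _ _ _ lp).
by rewrite /curry_hom (lfunE q) /= pvE.
Qed.

End Duality.

Section Forms.
Variables (F : fieldType) (V W : vectType F) (p : V -> W -> F).
Local Notation n := (\dim {:V}).
Local Notation e := (vbasis {:V}).

(* The basis (w_i) of W dual to (e_i), when p is a perfect pairing. *)
Definition dual_vec (i : 'I_n) : W :=
  (curry_hom (fun w v => p v w))^-1%VF (linfun (coord e i : V -> F^o)).

Lemma dual_vecP :
    (forall v, scalar (p v)) -> (forall w, scalar (p^~ w)) ->
    limg (curry_hom (fun w v => p v w)) = fullv ->
  forall i j : 'I_n, p e`_j (dual_vec i) = (i == j)%:R.
Proof.
move=> pr pl pfull i j; rewrite -[LHS](@curry_homE _ _ _ (fun w v => p v w)) //.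
rewrite /dual_vec limg_lfunVK ?pfull ?memvf //.
pose c : {linear V -> F^o} := HB.pack (coord e i : V -> F^o)
  (GRing.isLinear.Build _ _ F^o _ _ (@coord_is_scalar _ _ _ e i)).
by rewrite (lfunE c) /= coord_free ?(basis_free (vbasisP _)) // eq_sym.
Qed.

(* The multivectors of V corresponding to alternating forms f on W, with the  *)
(* convention (v ^ v')(w, w') = p v w * p v' w' - p v w' * p v' w.            *)
Definition mv2 (f : W -> W -> F) : exterior V :=
  \sum_(i < n) \sum_(j < n | (i < j)%N)
     f (dual_vec i) (dual_vec j) *: ext_wedge [:: e`_i; e`_j].

Definition mv3 (f : W -> W -> W -> F) : exterior V :=
  \sum_(i < n) \sum_(j < n | (i < j)%N) \sum_(k < n | (j < k)%N)
     f (dual_vec i) (dual_vec j) (dual_vec k) *: ext_wedge [:: e`_i; e`_j; e`_k].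

End Forms.

(** * The Schouten bracket *)

Section Schouten.
Variables (F : fieldType) (V : vectType F) (br : V -> V -> V).

Definition omit (s : seq V) (i : nat) : seq V := take i s ++ drop i.+1 s.

Definition schouten_wedge (s t : seq V) : exterior V :=
  \sum_(i < size s) \sum_(j < size t) (-1) ^+ (i + j) *:
    ext_wedge (br s`_i t`_j :: omit s i ++ omit t j).

(* The bilinear extension of schouten_wedge from the basis of blades. *)
Definition schouten (x y : exterior V) : exterior V :=
  \sum_S \sum_T (ext_coord x S * ext_coord y T) *:
    schouten_wedge (ext_basis S) (ext_basis T).

Definition schouten_span : {vspace exterior V} :=
  (\sum_S \sum_T <[schouten (ext_blade S) (ext_blade T)]>)%VS.

Lemma schouten_blade S T : schouten (ext_blade S) (ext_blade T) =
  schouten_wedge (ext_basis S) (ext_basis T).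
Proof.
rewrite /schouten (bigD1 S) //= [X in _ + X]big1 ?addr0 => [|S' neS]; last first.
  by apply: big1 => T' _; rewrite ext_coord_blade (negPf neS) mul0r scale0r.
rewrite (bigD1 T) //= [X in _ + X]big1 ?addr0 => [|T' neT].
  by rewrite !ext_coord_blade !eqxx mulr1 scale1r.
by rewrite [ext_coord _ T']ext_coord_blade (negPf neT) mulr0 scale0r.
Qed.

(* schouten_span is the linear span of all brackets. *)
Lemma schouten_spanP (U : {vspace exterior V}) :
  (schouten_span <= U)%VS <-> forall x y, schouten x y \in U.
Proof.
split=> [sU x y | bU].
  apply: memv_suml => S _; apply: memv_suml => T _; rewrite memvZ //.
  rewrite -schouten_blade; apply: (subvP sU); rewrite memvE.
  by apply: (sumv_sup S) => //; apply: (sumv_sup T).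
by apply/subv_sumP => S _; apply/subv_sumP => T _; rewrite -memvE.
Qed.

End Schouten.

(** * Cohomology of d : A -> A, where gr k is the degree k part of A *)

Section Cohomology.
Variables (F : fieldType) (A : vectType F).
Variables (d : 'End(A)) (gr : nat -> {vspace A}) (k : nat).

Definition cocycles : {vspace A} := (lker d :&: gr k)%VS.
Definition coboundaries : {vspace A} :=
  if k is k'.+1 then (d @: gr k')%VS else 0%VS.

(* Z^k / B^k, as a subspace of A / B^k. *)
Definition cohomology : {vspace quotv coboundaries} :=
  (qproj coboundaries @: cocycles)%VS.
Definition cohomology_class (x : A) : quotv coboundaries := qproj coboundaries x.

Lemma mem_cohomology x : x \in cocycles -> cohomology_class x \in cohomology.
Proof. exact: memv_img. Qed.

Lemma cohomology_class_eq0 x : (cohomology_class x == 0) = (x \in coboundaries).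
Proof. by rewrite -memv_ker lker_qproj. Qed.

End Cohomology.

(** * Lie algebras and Chevalley-Eilenberg cohomology *)

Definition is_lie_bracket (F : fieldType) (V : vectType F) (br : V -> V -> V) :=
  [/\ forall x, linear (br x), forall y, linear (br^~ y), forall x, br x x = 0
    & forall x y z, br x (br y z) + br y (br z x) + br z (br x y) = 0].

Section LieAlgebra.
Variables (F : fieldType) (g : vectType F) (br : g -> g -> g).
Local Notation dual := 'Hom(g, F^o).

(* Forms on g are elements of the exterior algebra of its dual; d is the odd *)
(* derivation with (d alpha)(x, y) = - alpha([x, y]).                         *)
Definition ce_diff : 'End(exterior dual) :=
  odd_deriv (fun alpha : dual =>
    mv2 (fun (xi : dual) (x : g) => xi x : F) (fun x y => - alpha (br x y))).

Definition ce_class (k : nat) (omega : exterior dual) :=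
  cohomology_class ce_diff (ext_pow {:dual}) k omega.

Definition is_ideal (I : {vspace g}) := forall x y, y \in I -> br x y \in I.

Definition annihilator (I : {vspace g}) : {vspace dual} :=
  lker (linfun (fun alpha : dual => (alpha \o projv I)%VF)).

Lemma annihilatorP (I : {vspace g}) (alpha : dual) :
  reflect (forall x, x \in I -> alpha x = 0) (alpha \in annihilator I).
Proof.
have l : linear (fun alpha : dual => (alpha \o projv I)%VF).
  by move=> a u v; rewrite comp_lfunDl comp_lfunZl.
pose f : {linear dual -> dual} := HB.pack (fun alpha : dual => (alpha \o projv I)%VF)
  (GRing.isLinear.Build _ _ _ _ _ l).
rewrite memv_ker (lfunE f) /=; apply: (iffP eqP) => [aI x Ix | aI].
  by rewrite -(projv_id Ix) -comp_lfunE aI zero_lfunE.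
by apply/lfunP=> x; rewrite comp_lfunE zero_lfunE aI // memv_proj.
Qed.

Definition quot_bracket (I : {vspace g}) (q r : quotv I) : quotv I :=
  qpi I (br (qrepr q) (qrepr r)).

Lemma quot_bracketE (I : {vspace g}) : is_lie_bracket br -> is_ideal I ->
  forall x y, quot_bracket (qpi I x) (qpi I y) = qpi I (br x y).
Proof.
move=> [brr brl alt _] idI x y; apply/eqP; rewrite qpi_eq.
set x' := qrepr _; set y' := qrepr _.
have Ix : x' - x \in I by rewrite -qpi_eq qreprK.
have Iy : y' - y \in I by rewrite -qpi_eq qreprK.
have brD a b c : br (a + b) c = br a c + br b c.
  by have := brl c 1 a b; rewrite !scale1r.
have brDr a b c : br a (b + c) = br a b + br a c.
  by have := brr a 1 b c; rewrite !scale1r.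
have anti a b : br a b = - br b a.
  apply/eqP; rewrite -addr_eq0; have := alt (a + b).
  by rewrite brD !brDr !alt add0r addr0 => ->.
have -> : br x' y' - br x y = br x' (y' - y) - br y (x' - x).
  have brN a b : br a (- b) = - br a b.
    by apply/eqP; rewrite -addr_eq0 -brDr addNr; apply/eqP;
       have := brr a (-1) 0 0; rewrite scaler0 addr0 scaleN1r addNr.
  by rewrite !brDr !brN (anti y x') (anti y x) !opprD !opprK addrA subrK.
by rewrite memvB // idI.
Qed.

End LieAlgebra.
Arguments quot_bracket {F g} br I q r.

(** * Lagrangian subspaces, Dirac structures and the obstruction class *)

Section Dirac.
Variables (F : fieldType) (E : vectType F).
Variables (pair : E -> E -> F) (br : E -> E -> E).
Implicit Types L M : {vspace E}.

Definition lagrangian L :=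
  forall x, x \in L <-> (forall y, y \in L -> pair x y = 0).
Definition dirac L :=
  lagrangian L /\ (forall x y, x \in L -> y \in L -> br x y \in L).
Definition complementary L M := (L + M)%VS = fullv /\ (L :&: M)%VS = 0%VS.
Definition lagrangian_complement L M := lagrangian M /\ complementary L M.
Definition dirac_complement L M := dirac M /\ complementary L M.

Lemma lagrangian_complement_exists L :
    (2%:R : F) != 0 -> (forall x, scalar (pair x)) ->
    (forall x y, pair x y = pair y x) ->
    (forall x, (forall y, pair x y = 0) -> x = 0) ->
  lagrangian L -> exists M, lagrangian_complement L M.
Proof.
move=> F2 pr psym pnd lagL; pose C := (L^C)%VS.
have pl y : scalar (pair^~ y) by move=> a u v; rewrite /= !(psym _ y) pr.
have pD x u v : pair x (u + v) = pair x u + pair x v.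
  by have := pr x 1 u v; rewrite scale1r mul1r.
have pDl x u v : pair (u + v) x = pair u x + pair v x by rewrite !(psym _ x) pD.
have p0 x : pair x 0 = 0.
  have := pD x 0 0; rewrite addr0 => /esym/eqP.
  by rewrite -subr_eq0 addrK => /eqP.
have pN x u : pair x (- u) = - pair x u.
  by apply/eqP; rewrite -addr_eq0 -pD addNr p0.
have pNl x u : pair (- u) x = - pair u x by rewrite !(psym _ x) pN.
have isoL l l' : l \in L -> l' \in L -> pair l l' = 0 by move/lagL; apply.
have dec y : exists l c, [/\ l \in L, c \in C & y = l + c].
  have : y \in (L + C)%VS by rewrite addv_complf memvf.
  by case/memv_addP => l Ll [c Cc ->]; exists l, c.
have L0 l : l \in L -> (forall c, c \in C -> pair l c = 0) -> l = 0.
  move=> Ll lC; apply: pnd => y; have [l' [c [Ll' Cc ->]]] := dec y.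
  by rewrite pD isoL // lC // addr0.
have C0 x : x \in L -> x \in C -> x = 0.
  by move=> Lx Cx; apply/eqP; rewrite -memv0 -(capv_compl L) memv_cap Lx.
pose psi := curry_hom (fun (l : subvs_of L) (c : subvs_of C) => pair (vsval l) (vsval c)).
pose phi := curry_hom (fun (c : subvs_of C) (l : subvs_of L) => pair (vsval c) (vsval l)).
have psiE l c : psi l c = pair (vsval l) (vsval c).
  by apply: curry_homE => ? ? ? ?; rewrite linearP /= ?pr ?pl.
have phiE c l : phi c l = pair (vsval c) (vsval l).
  by apply: curry_homE => ? ? ? ?; rewrite linearP /= ?pr ?pl.
have kpsi : lker psi = 0%VS.
  apply/eqP; rewrite -subv0; apply/subvP => l; rewrite memv_ker memv0 => /eqP l0.
  apply/eqP/val_inj/L0 => [|c Cc]; first exact: subvsP.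
  by rewrite -[c](vsprojK Cc) -psiE l0 zero_lfunE.
have kphi : lker phi = 0%VS.
  apply/eqP; rewrite -subv0; apply/subvP => c; rewrite memv_ker memv0 => /eqP c0.
  apply/eqP/val_inj/C0; last exact: subvsP.
  by apply/lagL => l Ll; rewrite -[l](vsprojK Ll) -phiE c0 zero_lfunE.
have dimD (U : {vspace E}) : \dim {: 'Hom(subvs_of U, F^o)} = \dim U.
  by rewrite dimvf [dim _]muln1.
have dsub (U : {vspace E}) : \dim {: subvs_of U} = \dim U by rewrite dimvf.
have psi_full : limg psi = fullv.
  apply/eqP; rewrite eqEdim subvf dimD limg_dim_eq ?kpsi ?capv0 // dsub.
  by rewrite -[X in (_ <= X)%N]dimD -dsub -(@limg_dim_eq _ _ _ phi) ?kphi ?capv0 // dimvS ?subvf.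
pose beta := curry_hom (fun c c' : subvs_of C => 2%:R^-1 * pair (vsval c) (vsval c')).
have betaE (c c' : subvs_of C) : beta c c' = 2%:R^-1 * pair (vsval c) (vsval c').
  by apply: curry_homE => ? ? ? ?; rewrite linearP /= ?pr ?pl mulrDr [in RHS]mulrCA.
pose h := (psi^-1 \o beta)%VF.
have hb c : psi (h c) = beta c.
  by rewrite comp_lfunE limg_lfunVK ?psi_full ?memvf.
have hE (c c' : subvs_of C) : pair (vsval (h c)) (vsval c') = 2%:R^-1 * pair (vsval c) (vsval c').
  by rewrite -betaE -hb psiE.
have hE2 (c c' : subvs_of C) :
    pair (vsval c) (vsval (h c')) = 2%:R^-1 * pair (vsval c) (vsval c').
  by rewrite psym hE psym.
pose val U : {linear subvs_of U -> E} := @vsval F E U.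
pose f := (linfun (val C) - (linfun (val L) \o h))%VF.
have fE (c : subvs_of C) : f c = vsval c - vsval (h c).
  by rewrite add_lfunE opp_lfunE comp_lfunE !lfunE.
have half2 (a : F) : a - 2%:R^-1 * a - 2%:R^-1 * a = 0.
  have h1 : 2%:R^-1 + 2%:R^-1 = 1 :> F by apply: (mulfI F2); rewrite mulrDr mulfV // mulr1.
  by rewrite -addrA -opprD -mulrDl h1 mul1r subrr.
have isoM (c c' : subvs_of C) : pair (f c) (f c') = 0.
  rewrite !fE pD !pDl !pN !pNl hE hE2.
  by rewrite (isoL (vsval (h c))) ?subvsP // !oppr0 addr0 half2.
exists (limg f); split; last split.
- move=> x; split=> [/memv_imgP[c _ ->] y /memv_imgP[c' _ ->] // | xM].
  have [l [c [Ll Cc xE]]] := dec x; pose c1 := vsproj C c.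
  have {}xE : x = (l + vsval (h c1)) + f c1.
    by rewrite fE vsprojK // addrACA subrr addr0.
  suff l0 : l + vsval (h c1) = 0 by rewrite xE l0 add0r memv_img ?memvf.
  have Ll1 : l + vsval (h c1) \in L by rewrite memvD ?subvsP.
  apply: L0 => // d Cd; have := xM (f (vsproj C d)) (memv_img _ (memvf _)).
  rewrite xE pDl isoM addr0 fE pD pN (isoL _ (vsval (h _))) ?subvsP //.
  by rewrite oppr0 addr0 vsprojK.
- apply/vspaceP=> x; rewrite memvf; have [l [c [Ll Cc ->]]] := dec x.
  pose c1 := vsproj C c; rewrite -[c](vsprojK Cc).
  have -> : l + vsval c1 = (l + vsval (h c1)) + f c1.
    by rewrite fE addrACA subrr addr0.
  by rewrite memv_add ?memvD ?subvsP // memv_img ?memvf.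
apply/eqP; rewrite -subv0; apply/subvP => x; rewrite memv_cap memv0.
case/andP=> Lx /memv_imgP[c _ xE]; have := xE; rewrite fE => xE'.
have c0 : vsval c = 0.
  apply: C0; last exact: subvsP.
  have -> : vsval c = x + vsval (h c) by rewrite xE' subrK.
  by rewrite memvD ?subvsP.
by rewrite xE (_ : c = 0) ?linear0 //; apply: val_inj.
Qed.

Section Obstruction.
Variable L : {vspace E}.

Definition restr_bracket (l l' : subvs_of L) : subvs_of L :=
  vsproj L (br (vsval l) (vsval l')).

Local Notation brackets := (schouten_span restr_bracket).

Local Notation a_ab := (quotv brackets).

Definition a_ab_gr (k : nat) : {vspace a_ab} :=
  (qproj brackets @: ext_pow {:subvs_of L} k)%VS.

Variable M : {vspace E}.

Definition restr_pair (l : subvs_of L) (m : subvs_of M) : F :=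
  pair (vsval l) (vsval m).

(* d_M and N_M, under the identification of L with the dual of M. *)
Definition d_compl : 'End(exterior (subvs_of L)) :=
  odd_deriv (fun l => mv2 restr_pair
    (fun m1 m2 => - pair (vsval l) (br (vsval m1) (vsval m2)))).

Definition N_compl : exterior (subvs_of L) :=
  mv3 restr_pair
    (fun m1 m2 m3 => pair (br (vsval m1) (vsval m2)) (vsval m3)).

(* d_M sends brackets to combinations of brackets when L is a Dirac structure *)
(* and M a lagrangian complement, so quot_end is the induced differential.    *)
Definition d_ab : 'End(a_ab) := quot_end brackets d_compl.

(* The class N^L, computed with the lagrangian complement M: neither d_ab nor *)
(* the class depends on the choice of M.                                      *)
Definition obstruction_class : quotv (coboundaries d_ab a_ab_gr 3) :=
  cohomology_class d_ab a_ab_gr 3 (qproj brackets N_compl).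

End Obstruction.
End Dirac.

(** * The quadratic Lie algebra (g + dual g)_H *)

Section Double.
Variables (F : fieldType) (g : vectType F) (br : g -> g -> g).
Local Notation dual := 'Hom(g, F^o).
Local Notation E := (g * dual)%type.

Definition double_pair (u v : E) : F := u.2 v.1 + v.2 u.1.

Definition lie_deriv (A : g) (beta : dual) : dual := - (beta \o linfun (br A))%VF.

(* The interior product, an odd derivation of degree -1. *)
Definition contraction (A : g) : 'End(exterior dual) :=
  odd_deriv (fun alpha : dual => (alpha A : F)%:A).

Definition double_bracket (H : exterior dual) (u v : E) : E :=
  (br u.1 v.1,
   lie_deriv u.1 v.2 - lie_deriv v.1 u.2
     + ext_degree1 (contraction v.1 (contraction u.1 H))).

Definition ideal_double (I : {vspace g}) : {vspace E} :=
  (linfun (fun A : g => (A, 0) : E) @: I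
     + linfun (fun alpha : dual => (0, alpha) : E) @: annihilator I)%VS.

Definition pullback (h : vectType F) (f : 'Hom(g, h)) :
    'Hom(exterior 'Hom(h, F^o), exterior dual) :=
  ext_map (linfun (fun alpha : 'Hom(h, F^o) => (alpha \o f)%VF)).

End Double.
Arguments double_pair {F} g u v.

(* Main.v *)
(** Projecting L = I + I^0 to (g/I)^* along I induces an algebra morphism pi from
    the exterior algebra of L to that of (g/I)^*. As [L, L] lies in I, pi kills all
    Schouten brackets.
    Dually, pi embeds g/I into M, sending x to X + xi_x with X a lift of x and xi_x in
    I^0. Evaluating on these vectors gives pi d_M = d pi, with d the
    Chevalley-Eilenberg differential of g/I, and pi N_M = Htilde + d omega, where
    omega(x, y) = xi_x(y) is alternating since M is isotropic. So if the class of N_M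
    vanishes, then Htilde is exact. A Dirac complement has N_M = 0. *)

From HB Require Import structures.
Require Import Defs.
From mathcomp Require Import all_boot all_order all_algebra all_field.
From mathcomp Require Import reals ring.

Set Implicit Arguments.
Unset Strict Implicit.
Unset Printing Implicit Defensive.

Import GRing.Theory.
Local Open Scope ring_scope.

(** * The universal property of the exterior algebra *)

(** Multivectors are coordinate families over one chosen basis of each space, and the bases of L and
    of the dual of g/I are unrelated, so the compatibility of pi with forms cannot be read off
    coordinates. The embedding of g/I into M is obtained as the adjoint [s] of the projection [P] of
    L, by <l, s x> = (P l)(x). The canonical tensors of the two pairings correspond under [P] and
    [s], whence pi (mv f) = mv (f o s) for alternating f. To see this, the sums over increasing
    indices in [mv2] and [mv3] are traded for sums over all indices, at the price of factors 2 and
    6, invertible over the reals. That s x has the form X + xi_x holds because s x - (X, 0) is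
    orthogonal to L, hence lies in L. The term d omega of pi N_M collects the three terms of
    <[s x, s y], s z> in which some xi is applied to a Lie bracket of lifts; the twist alone gives
    Htilde. *)

Lemma enum_setU1_min n (i : 'I_n) (S : {set 'I_n}) :
  (forall j, j \in S -> (i < j)%N) -> enum (i |: S) = i :: enum S.
Proof.
move=> ltiS; have sorted_enum_ltn (T : {set 'I_n}) :
    sorted (relpre (@nat_of_ord n) ltn) (enum T).
  rewrite /enum_mem -enumT sorted_filter //.
    by move=> ? ? ?; exact: ltn_trans.
  by rewrite -sorted_map val_enum_ord iota_ltn_sorted.
apply: (@irr_sorted_eq _ (relpre (@nat_of_ord n) ltn)) => //.
- by move=> ? ? ?; exact: ltn_trans.
- by move=> ?; exact: ltnn.
- rewrite /= path_min_sorted //; apply/allP => j.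
  by rewrite mem_enum => /ltiS.
- by move=> j; rewrite inE !mem_enum !inE.
Qed.

(** The case without transposition, hence without sign; [ext_fold_blade1M] reduces every other
    product to it. *)
Lemma ext_blade1M_min (F : fieldType) (V : vectType F) (i : 'I_(\dim {:V}))
    (S : {set 'I_(\dim {:V})}) :
  (forall j, j \in S -> (i < j)%N) ->
  ext_blade [set i] * ext_blade S = ext_blade (i |: S) :> exterior V.
Proof.
move=> ltiS; rewrite -!ext_wedge_basis /ext_basis enum_set1 enum_setU1_min //=.
by rewrite /ext_wedge !big_cons big_nil mulr1.
Qed.

Lemma ext_coord_sum_linear (F : fieldType) (V : vectType F) (X : lmodType F)
    (G : {set 'I_(\dim {:V})} -> X) :
  linear (fun x : exterior V => \sum_S ext_coord x S *: G S).
Proof.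
move=> a x y; rewrite scaler_sumr -big_split; apply: eq_bigr => S _ /=.
by rewrite ext_coordD ext_coordZ scalerDl scalerA.
Qed.

(* A map K : V -> End X with K v (K v x) = 0 extends to an action of the exterior
   algebra on X; ext_fold is its orbit map at x0. *)
Section ExteriorFold.
Variables (F : fieldType) (V : vectType F) (X : lmodType F).
Variables (K : V -> X -> X) (x0 : X).
Hypotheses (Kl : forall x, linear (K^~ x)) (Kr : forall v, linear (K v)).
Hypothesis KK : forall v x, K v (K v x) = 0.
Local Notation e := (vbasis {:V}).

Definition ext_fold (x : exterior V) : X :=
  \sum_S ext_coord x S *: foldr K x0 (ext_basis S).

Lemma ext_fold_linear : linear ext_fold.
Proof. exact: ext_coord_sum_linear. Qed.
HB.instance Definition _ :=
  GRing.isLinear.Build F (exterior V) X _ ext_fold ext_fold_linear.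

Lemma ext_fold_blade S : ext_fold (ext_blade S) = foldr K x0 (ext_basis S).
Proof.
rewrite /ext_fold (bigD1 S) //= big1 ?addr0 => [|T neTS].
  by rewrite ext_coord_blade eqxx scale1r.
by rewrite ext_coord_blade (negPf neTS) scale0r.
Qed.

Let Km v : {linear X -> X} := HB.pack (K v) (GRing.isLinear.Build _ _ _ _ _ (Kr v)).
Let Kv x : {linear V -> X} := HB.pack (K^~ x) (GRing.isLinear.Build _ _ _ _ _ (Kl x)).

Let K0r v : K v 0 = 0. Proof. exact: (linear0 (Km v)). Qed.
Let KZr v a x : K v (a *: x) = a *: K v x. Proof. exact: (linearZZ (Km v)). Qed.

Let KZl a v x : K (a *: v) x = a *: K v x. Proof. exact: (linearZZ (Kv x)). Qed.
Let Ksumr v I r (P : pred I) G :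
  K v (\sum_(i <- r | P i) G i) = \sum_(i <- r | P i) K v (G i).
Proof. exact: (linear_sum (Km v)). Qed.
Let Ksuml x I r (P : pred I) G :
  K (\sum_(i <- r | P i) G i) x = \sum_(i <- r | P i) K (G i) x.
Proof. exact: (linear_sum (Kv x)). Qed.

(** Polarisation of [KK] at u + v. *)
Let KC u v x : K u (K v x) = - K v (K u x).
Proof.
have KD a b y : K (a + b) y = K a y + K b y by exact: (linearD (Kv y)).
have KDr a y z : K a (y + z) = K a y + K a z by exact: (linearD (Km a)).
apply/eqP; rewrite -addr_eq0; have := KK (u + v) x.
by rewrite !KD !KDr !KK add0r addr0 => ->.
Qed.

Let ext_fold_min (i : 'I_(\dim {:V})) (S : {set 'I_(\dim {:V})}) :
  (forall j, j \in S -> (i < j)%N) ->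
  ext_fold (ext_blade [set i] * ext_blade S) = K e`_i (ext_fold (ext_blade S)).
Proof.
by move=> ltiS; rewrite ext_blade1M_min // !ext_fold_blade /ext_basis enum_setU1_min.
Qed.

(** Induction on the size of S, comparing i with the least element j of S. If i > j, then e_i is
    moved past e_j on the left and [K e_i] past [K e_j] on the right, with the same sign, and the
    induction hypothesis applies to S without j. *)
Let ext_fold_blade1M (i : 'I_(\dim {:V})) (S : {set 'I_(\dim {:V})}) :
  ext_fold (ext_blade [set i] * ext_blade S) = K e`_i (ext_fold (ext_blade S)).
Proof.
have [m] := ubnP #|S|; elim: m S i => // m IHm S i ltSm.
have [->|/set0Pn[k Sk]] := eqVneq S set0; first by apply: ext_fold_min => j; rewrite inE.
case: (arg_minnP (@nat_of_ord _) Sk) => j Sj minj; pose T := S :\ j.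
have ltjT l : l \in T -> (j < l)%N.
  by rewrite !inE => /andP[nelj /minj]; rewrite leq_eqVlt eq_sym (inj_eq val_inj) (negPf nelj).
have ST : S = j |: T by rewrite setD1K.
have [ltij|] := ltnP i j.
  by apply: ext_fold_min => l /minj; exact: leq_trans.
rewrite ST -(ext_blade1M_min ltjT) (ext_fold_min ltjT) leq_eqVlt => /orP[/eqP/val_inj<-|ltji].
  by rewrite mulrA ext_blade1_sqr mul0r KK linear0.
have /eqP := @ext_blade1C F V i j; rewrite addr_eq0 mulrA => /eqP->.
rewrite mulNr linearN KC; congr (- _).
rewrite -IHm; last by move: ltSm; rewrite ST cardsU1 !inE eqxx.
(* The product of e_i with the blade of T is zero or, up to sign, a blade with all indices above j,
   from which [ext_fold_min] extracts e_j. *)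
rewrite -mulrA ext_bladeM /ext_mul_blade; case: ifP => _; last by rewrite mulr0 !linear0 K0r.
rewrite -scalerAr !linearZ KZr /=; congr (_ *: _); apply: ext_fold_min => l.
by rewrite !inE => /predU1P[->//|]; rewrite -in_setD1; exact: ltjT.
Qed.

Lemma ext_fold_vecM v x : ext_fold (ext_vec v * x) = K v (ext_fold x).
Proof.
rewrite [x]ext_blade_sum mulr_sumr !linear_sum Ksumr.
apply: eq_bigr => S _; rewrite -scalerAr !linearZ KZr /=; congr (_ *: _).
rewrite [v in RHS](coord_vbasis (memvf v)) Ksuml.
rewrite /ext_vec mulr_suml linear_sum; apply: eq_bigr => i _.
by rewrite -scalerAl linearZ /= ext_fold_blade1M KZl.
Qed.

(** This frees the formulas from the chosen basis: [ext_fold] is defined on blades, but its value is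
    now known on products of arbitrary vectors. The rules for [ext_map] and [odd_deriv] are
    instances. *)
Lemma ext_fold_wedge s : ext_fold (ext_wedge s) = foldr K x0 s.
Proof.
elim: s => [|v s IHs] /=; last by rewrite /ext_wedge big_cons ext_fold_vecM IHs.
rewrite /ext_wedge big_nil -[1]/(ext_blade set0) ext_fold_blade.
by rewrite /ext_basis enum_set0.
Qed.

End ExteriorFold.

Lemma linfunE (F : fieldType) (V W : vectType F) (f : V -> W) :
  linear f -> linfun f =1 f.
Proof.
move=> lf; pose f' : {linear V -> W} := HB.pack f (GRing.isLinear.Build _ _ _ _ _ lf).
exact: (lfunE f').
Qed.

(** * Induced morphisms and odd derivations *)

Section ExteriorAlgebraTheory.
Variables (F : fieldType).
Implicit Types V W : vectType F.

Lemma ext_wedge_nil V : ext_wedge [::] = 1 :> exterior V.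
Proof. exact: big_nil. Qed.

Lemma ext_wedge_cons V (v : V) s : ext_wedge (v :: s) = ext_vec v * ext_wedge s.
Proof. exact: big_cons. Qed.

Lemma ext_wedge_cat V (s t : seq V) : ext_wedge (s ++ t) = ext_wedge s * ext_wedge t.
Proof. exact: big_cat. Qed.

Lemma ext_wedge1 V (v : V) : ext_wedge [:: v] = ext_vec v.
Proof. by rewrite ext_wedge_cons ext_wedge_nil mulr1. Qed.

Lemma ext_wedge2 V (u v : V) : ext_wedge [:: u; v] = ext_vec u * ext_vec v.
Proof. by rewrite ext_wedge_cons ext_wedge1. Qed.

Lemma ext_wedge3 V (u v w : V) :
  ext_wedge [:: u; v; w] = ext_vec u * ext_vec v * ext_vec w.
Proof. by rewrite ext_wedge_cons ext_wedge2 mulrA. Qed.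

Lemma ext_vecC V (u v : V) : ext_vec u * ext_vec v = - (ext_vec v * ext_vec u).
Proof.
apply/eqP; rewrite -addr_eq0; have := ext_vec_sqr (u + v).
by rewrite linearD mulrDl !mulrDr !ext_vec_sqr add0r addr0 => ->.
Qed.

Lemma ext_wedge_ind V (X : lmodType F) (f h : exterior V -> X) :
  linear f -> linear h -> (forall s, f (ext_wedge s) = h (ext_wedge s)) -> f =1 h.
Proof. by move=> lf lh fh; apply: ext_blade_ind => // S; rewrite -ext_wedge_basis. Qed.

Lemma ext_map_wedge V W (f : 'Hom(V, W)) s :
  ext_map f (ext_wedge s) = ext_wedge (map f s).
Proof.
(* [ext_map f] is the fold for the action of v by left multiplication with f v. *)
pose K (v : V) (x : exterior W) : exterior W := ext_vec (f v) * x.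
have Kl x : linear (K^~ x) by move=> a u v; rewrite /K !linearP mulrDl scalerAl.
have Kr v : linear (K v) by move=> a x y; rewrite /K mulrDr scalerAr.
have KK v x : K v (K v x) = 0 by rewrite /K mulrA ext_vec_sqr mul0r.
have foldE t : foldr K 1 t = ext_wedge (map f t).
  by elim: t => [|v t /= ->]; rewrite ?ext_wedge_nil ?ext_wedge_cons.
rewrite -foldE -(ext_fold_wedge _ Kl Kr KK).
rewrite /ext_map linfunE; last exact: ext_coord_sum_linear.
by apply: eq_bigr => S _; rewrite foldE.
Qed.

Lemma ext_mapM V W (f : 'Hom(V, W)) x y : ext_map f (x * y) = ext_map f x * ext_map f y.
Proof.
move: x; apply: ext_wedge_ind => [a u v|a u v|s]; rewrite ?mulrDl -?scalerAl ?linearP //=.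
  by rewrite mulrDl scalerAl.
move: y; apply: ext_wedge_ind => [a u v|a u v|t]; rewrite ?mulrDr -?scalerAr ?linearP //=.
  by rewrite mulrDr scalerAr.
by rewrite -ext_wedge_cat !ext_map_wedge map_cat ext_wedge_cat.
Qed.

Lemma ext_map_vec V W (f : 'Hom(V, W)) v : ext_map f (ext_vec v) = ext_vec (f v).
Proof. by rewrite -!ext_wedge1 ext_map_wedge. Qed.

(** By functoriality, a left inverse of [f] induces one of [ext_map f]. *)
Lemma ext_map_inj V W (f : 'Hom(V, W)) : lker f == 0%VS -> injective (ext_map f).
Proof.
move=> kf; apply: (can_inj (g := ext_map f^-1%VF)) => x.
rewrite -[RHS](id_lfunE x) -comp_lfunE; congr (fun_of_lfun _ _).
apply/lfunP; apply: ext_wedge_ind => [a u v|a u v|s]; rewrite ?linearP //.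
rewrite comp_lfunE id_lfunE !ext_map_wedge -map_comp; congr ext_wedge.
by rewrite -[RHS]map_id; apply: eq_map => v /=; rewrite lker0_lfunK.
Qed.

Lemma odd_deriv_wedgeE V (delta : V -> exterior V) s :
  linear delta -> (forall v, ext_vec v * delta v = delta v * ext_vec v) ->
  odd_deriv delta (ext_wedge s) = odd_deriv_wedge delta s.
Proof.
(* Fold the pair (x, D x), on which v acts by (v x, delta v x - v D x). *)
move=> ldelta comm_delta; pose X := (exterior V * exterior V)%type.
pose deltaL : {linear V -> exterior V} :=
  HB.pack delta (GRing.isLinear.Build _ _ _ _ _ ldelta).
have dP a u v : delta (a *: u + v) = a *: delta u + delta v by exact: ldelta.
pose K (v : V) (x : X) : X := (ext_vec v * x.1, delta v * x.1 - ext_vec v * x.2).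
have Kl x : linear (K^~ x).
  move=> a u v; rewrite /K dP linearP /=; congr pair => /=.
    by rewrite mulrDl scalerAl.
  by rewrite !mulrDl -!scalerAl scalerBr opprD addrACA.
have Kr v : linear (K v).
  move=> a x y; rewrite /K /=; congr pair => /=; rewrite !mulrDr -?scalerAr //.
  by rewrite scalerBr opprD addrACA.
(* The second component is delta v (v x) - v (delta v x); the commutation of v with [delta v] makes
   it vanish. *)
have KK v x : K v (K v x) = 0.
  rewrite /K /=; congr pair; first by rewrite mulrA ext_vec_sqr mul0r.
  by rewrite mulrBr !mulrA ext_vec_sqr mul0r subr0 comm_delta subrr.
have foldE t : foldr K (1, 0) t = (ext_wedge t, odd_deriv_wedge delta t).
  by elim: t => [|v t /= ->]; rewrite ?ext_wedge_nil ?ext_wedge_cons.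
transitivity (ext_fold K (1, 0) (ext_wedge s)).2; last first.
  by rewrite (ext_fold_wedge _ Kl Kr KK) foldE.
rewrite /odd_deriv linfunE; last exact: ext_coord_sum_linear.
rewrite /ext_fold (big_morph _ (fun x y : X => erefl (x + y).2) (erefl (0 : X).2)).
by apply: eq_bigr => S _; rewrite foldE.
Qed.
End ExteriorAlgebraTheory.

Lemma ext_vec2C (F : fieldType) (V : vectType F) (u v w : V) :
  ext_vec u * (ext_vec v * ext_vec w) = ext_vec v * ext_vec w * ext_vec u.
Proof. by rewrite mulrA (ext_vecC u v) mulNr -!mulrA (ext_vecC u w) mulrN opprK. Qed.

Section OddDerivation.
Variables (F : fieldType) (V : vectType F) (delta : V -> exterior V).
Hypotheses (delta_linear : linear delta)
  (delta_comm : forall v, ext_vec v * delta v = delta v * ext_vec v).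

Lemma odd_deriv1 : odd_deriv delta 1 = 0.
Proof. by rewrite -(ext_wedge_nil V) odd_deriv_wedgeE. Qed.

Lemma odd_deriv_vecM v x :
  odd_deriv delta (ext_vec v * x) = delta v * x - ext_vec v * odd_deriv delta x.
Proof.
move: x; apply: ext_wedge_ind => [a x y|a x y|s].
- by rewrite mulrDr -scalerAr linearP.
- by rewrite linearP !mulrDr -!scalerAr scalerBr opprD addrACA.
by rewrite -ext_wedge_cons !odd_deriv_wedgeE.
Qed.

Lemma odd_deriv_vec v : odd_deriv delta (ext_vec v) = delta v.
Proof. by rewrite -[ext_vec v]mulr1 odd_deriv_vecM odd_deriv1 mulr0 subr0 mulr1. Qed.

End OddDerivation.

(** On the source only blades are met, where [odd_deriv delta] is its recursive formula by
    definition. On the target the images of basis vectors are arbitrary, so [odd_deriv_wedgeE] is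
    applied there, to [delta']. *)
Lemma ext_map_odd_deriv (F : fieldType) (V W : vectType F) (f : 'Hom(V, W))
    (delta : V -> exterior V) (delta' : W -> exterior W) :
  linear delta' -> (forall w, ext_vec w * delta' w = delta' w * ext_vec w) ->
  (forall v, ext_map f (delta v) = delta' (f v)) ->
  forall x, ext_map f (odd_deriv delta x) = odd_deriv delta' (ext_map f x).
Proof.
move=> ldelta' comm' fdelta x.
have -> : odd_deriv delta x =
    \sum_S ext_coord x S *: odd_deriv_wedge delta (ext_basis S).
  exact/linfunE/ext_coord_sum_linear.
rewrite [in RHS](ext_blade_sum x) !linear_sum; apply: eq_bigr => S _.
rewrite !linearZ /=; congr (_ *: _).
rewrite -ext_wedge_basis ext_map_wedge odd_deriv_wedgeE //.
elim: (ext_basis S) => [|v s IHs] /=; first by rewrite linear0.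
by rewrite linearB /= !ext_mapM IHs fdelta ext_map_wedge ext_map_vec.
Qed.

Lemma linear_sumZ (F : fieldType) (V X : lmodType F) (h : V -> X) :
  linear h -> forall I r (P : pred I) (a : I -> F) v,
  h (\sum_(i <- r | P i) a i *: v i) = \sum_(i <- r | P i) a i *: h (v i).
Proof.
move=> lh I r P a v; pose h' : {linear V -> X} := HB.pack h (GRing.isLinear.Build _ _ _ _ _ lh).
by rewrite -[LHS]/(h' _) linear_sum; apply: eq_bigr => i _; rewrite linearZ.
Qed.

Lemma scalar_sumZ (F : fieldType) (V : lmodType F) (h : V -> F) :
  scalar h -> forall I r (P : pred I) (a : I -> F) v,
  h (\sum_(i <- r | P i) a i *: v i) = \sum_(i <- r | P i) a i * h (v i).
Proof. exact: (@linear_sumZ F V F^o). Qed.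

Section ScalarMorphism.
Variables (F : fieldType) (V : lmodType F) (h : V -> F).
Hypothesis hs : scalar h.
Let h' : {scalar V} := HB.pack h (GRing.isLinear.Build _ _ _ _ _ hs).

Lemma scalar_fun0 : h 0 = 0. Proof. exact: (linear0 h'). Qed.
Lemma scalar_funZ a x : h (a *: x) = a * h x. 
Proof. by have := hs a x 0; rewrite !addr0 scalar_fun0 addr0. Qed.
Lemma scalar_funN x : h (- x) = - h x. Proof. exact: (linearN h'). Qed.
Lemma scalar_funD x y : h (x + y) = h x + h y. Proof. exact: (linearD h'). Qed.
Lemma scalar_funB x y : h (x - y) = h x - h y. Proof. exact: (linearB h'). Qed.

End ScalarMorphism.

(** * Perfect pairings and dual bases *)

Section PerfectPairing.
Variables (F : fieldType) (V W : vectType F) (p : V -> W -> F).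
Local Notation e := (vbasis {:V}).

Definition perfect_pairing :=
  [/\ forall v, scalar (p v), forall w, scalar (p^~ w),
      forall v, (forall w, p v w = 0) -> v = 0
    & forall w, (forall v, p v w = 0) -> w = 0].

Hypothesis p_perfect : perfect_pairing.
Let pr v : scalar (p v). Proof. by case: p_perfect. Qed.
Let pl w : scalar (p^~ w). Proof. by case: p_perfect. Qed.

(** Each space embeds into the dual of the other, so their dimensions agree and the embedding of W
    into the dual of V is onto. *)
Lemma perfect_limg : limg (curry_hom (fun w v => p v w)) = fullv.
Proof.
case: p_perfect => _ _ ndl ndr.
have dim_dual (U : vectType F) : \dim {: 'Hom(U, F^o)} = \dim {:U}.
  by rewrite !dimvf [dim _]muln1.
have k1 : lker (curry_hom p) == 0%VS.
  rewrite -subv0; apply/subvP => v; rewrite memv_ker memv0 => /eqP v0.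
  by apply/eqP/ndl => w; rewrite -(curry_homE pr pl) v0 zero_lfunE.
have k2 : lker (curry_hom (fun w v => p v w)) == 0%VS.
  rewrite -subv0; apply/subvP => w; rewrite memv_ker memv0 => /eqP w0.
  by apply/eqP/ndr => v; rewrite -(@curry_homE _ _ _ (fun w v => p v w)) // w0 zero_lfunE.
apply/eqP; rewrite eqEdim subvf dim_dual limg_dim_eq ?(eqP k2) ?capv0 //.
rewrite -[X in (_ <= X)%N]dim_dual -(@limg_dim_eq _ _ _ (curry_hom p) fullv).
  by rewrite dimvS ?subvf.
by rewrite (eqP k1) capv0.
Qed.

Lemma pair_dual_vec (i j : 'I_(\dim {:V})) : p e`_j (dual_vec p i) = (i == j)%:R.
Proof. exact/dual_vecP/perfect_limg. Qed.

Lemma basis_expand v : v = \sum_(i < \dim {:V}) p v (dual_vec p i) *: e`_i.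
Proof.
rewrite {1}(coord_vbasis (memvf v)); apply: eq_bigr => i _; congr (_ *: _).
rewrite {2}(coord_vbasis (memvf v)) (scalar_sumZ (pl _)) (bigD1 i) //= big1.
  by rewrite pair_dual_vec eqxx addr0 mulr1.
by move=> j neji; rewrite pair_dual_vec eq_sym (negPf neji) mulr0.
Qed.

Lemma dual_expand w : w = \sum_(i < \dim {:V}) p e`_i w *: dual_vec p i.
Proof.
apply/eqP; rewrite -subr_eq0; apply/eqP; case: (p_perfect) => _ _ _; apply=> v.
rewrite (scalar_funB (pr v)) (scalar_sumZ (pr _)) {1}(basis_expand v) (scalar_sumZ (pl _)).
apply/eqP; rewrite subr_eq0; apply/eqP.
by apply: eq_bigr => i _; rewrite mulrC.
Qed.

Lemma sum_dual_vec (X : lmodType F) (g : W -> X) : linear g ->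
  forall w, g w = \sum_(i < \dim {:V}) p e`_i w *: g (dual_vec p i).
Proof. by move=> lg w; rewrite {1}(dual_expand w) (linear_sumZ lg). Qed.

Lemma sum_basis (X : lmodType F) (g : V -> X) : linear g ->
  forall v, g v = \sum_(i < \dim {:V}) p v (dual_vec p i) *: g e`_i.
Proof. by move=> lg v; rewrite {1}(basis_expand v) (linear_sumZ lg). Qed.

End PerfectPairing.

(** The canonical tensor of a pair of dual bases represents the identity map. Applying [P] to one
    factor of the tensor of p, or [s] to the other factor of the tensor of p', gives two expressions
    of the tensor that represents [P]. *)
Lemma sum_dual_adjoint (F : fieldType) (V W V' W' : vectType F)
    (p : V -> W -> F) (p' : V' -> W' -> F) (P : V -> V') (s : W' -> W) (X : lmodType F)
    (G : W -> V' -> X) :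
  perfect_pairing p -> perfect_pairing p' ->
  (forall v w', p v (s w') = p' (P v) w') ->
  (forall v', linear (G^~ v')) -> (forall w, linear (G w)) ->
  \sum_(i < \dim {:V}) G (dual_vec p i) (P (vbasis {:V})`_i) =
  \sum_(i < \dim {:V'}) G (s (dual_vec p' i)) (vbasis {:V'})`_i.
Proof.
move=> pp pp' adj Gl Gr.
under eq_bigr => i _ do rewrite (sum_basis pp' (Gr _)).
rewrite exchange_big; apply: eq_bigr => a _.
rewrite (sum_dual_vec pp (Gl _)); apply: eq_bigr => i _.
by rewrite adj.
Qed.

(** In the applications G is a coefficient of an alternating form times a product of vectors; both
    change sign under a swap, so G is symmetric. *)
Lemma sum_ltn2 n (Z : zmodType) (G : 'I_n -> 'I_n -> Z) :
  (forall i j, G i j = G j i) -> (forall i, G i i = 0) ->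
  \sum_i \sum_j G i j = (\sum_(i < n) \sum_(j < n | (i < j)%N) G i j) *+ 2.
Proof.
move=> Gsym G0; pose A (i j : 'I_n) : Z := if (i < j)%N then G i j else 0.
have GA i j : G i j = A i j + A j i.
  rewrite /A; case: ltngtP => [||/val_inj->]; rewrite ?addr0 ?add0r ?G0 // => _.
under eq_bigr => i _ do under eq_bigr => j _ do rewrite GA.
under eq_bigr => i _ do rewrite big_split.
rewrite big_split /= [X in _ + X]exchange_big /= mulr2n.
by under [in RHS]eq_bigr => i _ do rewrite big_mkcond.
Qed.

Lemma sum_ltn3 n (Z : zmodType) (G : 'I_n -> 'I_n -> 'I_n -> Z) :
  (forall i j k, G i j k = G j i k) -> (forall i j k, G i j k = G i k j) ->
  (forall i k, G i i k = 0) ->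
  \sum_i \sum_j \sum_k G i j k =
  (\sum_(i < n) \sum_(j < n | (i < j)%N) \sum_(k < n | (j < k)%N) G i j k) *+ 6.
Proof.
move=> G12 G23 G0.
pose A (i j k : 'I_n) : Z := if (i < j)%N then if (j < k)%N then G i j k else 0 else 0.
pose S (B : 'I_n -> 'I_n -> 'I_n -> Z) := \sum_i \sum_j \sum_k B i j k.
have rot i j k : G i j k = G j k i by rewrite G12 G23.
have rot2 i j k : G i j k = G k i j by rewrite -rot.
have rev i j k : G i j k = G k j i by rewrite G12 rot2.
have Gjj i k : G i k k = 0 by rewrite rot.
have Gii i k : G k i k = 0 by rewrite rot2.
(* For distinct indices exactly one of the six orderings is increasing, and if two indices coincide
   then G vanishes. *)
have GA i j k : G i j k =
    A i j k + A i k j + (A j i k + A j k i) + (A k i j + A k j i).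
  rewrite /A; case: (ltngtP i j) => [ltij|ltji|/val_inj eqij];
    case: (ltngtP j k) => [ltjk|ltkj|/val_inj eqjk];
    case: (ltngtP i k) => [ltik|ltki|/val_inj eqik];
    rewrite ?addr0 ?add0r //; subst; rewrite ?G0 ?Gii ?Gjj //;
    (* The remaining cases are the cyclic ones, i < j < k < i and its reverse. *)
    try by [have := ltn_trans (ltn_trans ltij ltjk) ltki; rewrite ltnn
           |have := ltn_trans (ltn_trans ltkj ltji) ltik; rewrite ltnn].
under eq_bigr => i _ do under eq_bigr => j _ do under eq_bigr => k _ do rewrite GA.
have SD B C : S (fun i j k => B i j k + C i j k) = S B + S C.
  rewrite /S -big_split; apply: eq_bigr => i _; rewrite -big_split.
  by apply: eq_bigr => j _; rewrite -big_split.
rewrite -/(S _) !SD.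
have S12 B : S (fun i j k => B j i k) = S B by rewrite /S exchange_big.
have S23 B : S (fun i j k => B i k j) = S B.
  by apply: eq_bigr => i _; rewrite exchange_big.
have Srot B : S (fun i j k => B j k i) = S B.
  by rewrite (S12 (fun i j k => B i k j)) S23.
have Srot2 B : S (fun i j k => B k i j) = S B.
  by rewrite (S23 (fun i j k => B j i k)) S12.
have Srev B : S (fun i j k => B k j i) = S B.
  by rewrite (S12 (fun i j k => B k i j)) Srot2.
rewrite (S23 A) (S12 A) (Srot A) (Srot2 A) (Srev A).
have -> : S A = \sum_(i < n) \sum_(j < n | (i < j)%N) \sum_(k < n | (j < k)%N) G i j k.
  apply: eq_bigr => i _; rewrite [RHS]big_mkcond; apply: eq_bigr => j _; rewrite /A.
  by case: ifP => _; [rewrite [RHS]big_mkcond | rewrite big1].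
by rewrite -!mulr2n -mulrnA -mulrnDr.
Qed.

(** * Forms as multivectors *)

Section FormSums.
Variables (F : fieldType) (V W : vectType F) (p : V -> W -> F).
Local Notation n := (\dim {:V}).
Local Notation e i := (ext_vec (vbasis {:V})`_i).
Local Notation w i := (dual_vec p i).

(** For alternating f this is twice [mv2]. Unlike [mv2] it does not refer to the order of the basis,
    so it is a contraction with canonical tensors and is natural. *)
Definition form2_sum (f : W -> W -> F) : exterior V :=
  \sum_(i < n) \sum_(j < n) f (w i) (w j) *: (e i * e j).

Definition form3_sum (f : W -> W -> W -> F) : exterior V :=
  \sum_(i < n) \sum_(j < n) \sum_(k < n) f (w i) (w j) (w k) *: (e i * e j * e k).

Lemma mv2_sum f : (forall x y, f x y = - f y x) -> mv2 p f *+ 2 = form2_sum f.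
Proof.
move=> fC; rewrite /form2_sum sum_ltn2 => [|i j|i].
- congr (_ *+ _); apply: eq_bigr => i _; apply: eq_bigr => j _.
  by rewrite ext_wedge2.
- by rewrite fC ext_vecC scalerN scaleNr opprK.
- by rewrite ext_vec_sqr scaler0.
Qed.

Lemma mv3_sum f :
  (forall x y z, f x y z = - f y x z) -> (forall x y z, f x y z = - f x z y) ->
  mv3 p f *+ 6 = form3_sum f.
Proof.
move=> fC12 fC23; rewrite /form3_sum sum_ltn3 => [|i j k|i j k|i k].
- congr (_ *+ _); apply: eq_bigr => i _; apply: eq_bigr => j _.
  by apply: eq_bigr => k _; rewrite ext_wedge3.
- by rewrite fC12 (ext_vecC (vbasis _)`_i) mulNr scalerN scaleNr opprK.
- by rewrite fC23 -!mulrA (ext_vecC (vbasis _)`_j) mulrN scalerN scaleNr opprK.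
- by rewrite ext_vec_sqr mul0r scaler0.
Qed.

Lemma eq_form3_sum f1 f2 : (forall x y z, f1 x y z = f2 x y z) ->
  form3_sum f1 = form3_sum f2.
Proof.
move=> ef; apply: eq_bigr => i _; apply: eq_bigr => j _; apply: eq_bigr => k _.
by rewrite ef.
Qed.

Lemma form3_sum_lincomb a f1 f2 : form3_sum (fun x y z => a * f1 x y z + f2 x y z) =
  a *: form3_sum f1 + form3_sum f2.
Proof.
rewrite /form3_sum scaler_sumr -big_split; apply: eq_bigr => i _.
rewrite scaler_sumr -big_split; apply: eq_bigr => j _.
rewrite scaler_sumr -big_split; apply: eq_bigr => k _.
by rewrite scalerDl scalerA.
Qed.

Lemma form3_sumD f1 f2 :
  form3_sum (fun x y z => f1 x y z + f2 x y z) = form3_sum f1 + form3_sum f2.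
Proof.
rewrite -[form3_sum f1]scale1r -form3_sum_lincomb; apply: eq_form3_sum => x y z.
by rewrite mul1r.
Qed.

Lemma form3_sumB f1 f2 :
  form3_sum (fun x y z => f1 x y z - f2 x y z) = form3_sum f1 - form3_sum f2.
Proof.
rewrite addrC -scaleN1r -form3_sum_lincomb; apply: eq_form3_sum => x y z.
by rewrite mulN1r addrC.
Qed.

Lemma mv2_comm f v : ext_vec v * mv2 p f = mv2 p f * ext_vec v.
Proof.
rewrite /mv2 mulr_sumr mulr_suml; apply: eq_bigr => i _.
rewrite mulr_sumr mulr_suml; apply: eq_bigr => j _.
by rewrite -scalerAr -scalerAl ext_wedge2 ext_vec2C.
Qed.

Lemma mv2_linear (X : lmodType F) (h : X -> W -> W -> F) :
  (forall x y, scalar (fun a => h a x y)) -> linear (fun a => mv2 p (h a)).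
Proof.
move=> lh a u v; rewrite /mv2 scaler_sumr -big_split; apply: eq_bigr => i _ /=.
rewrite scaler_sumr -big_split; apply: eq_bigr => j _ /=.
by rewrite lh scalerDl scalerA.
Qed.

End FormSums.

Section FormAdjoint.
Variables (F : fieldType) (V W V' W' : vectType F) (p : V -> W -> F) (p' : V' -> W' -> F).
Variables (P : 'Hom(V, V')) (s : W' -> W).
Hypotheses (pp : perfect_pairing p) (pp' : perfect_pairing p').
Hypothesis adj : forall v w', p v (s w') = p' (P v) w'.

Lemma ext_map_form2_sum f :
  (forall x, scalar (f x)) -> (forall y, scalar (f^~ y)) ->
  ext_map P (form2_sum p f) = form2_sum p' (fun x y => f (s x) (s y)).
Proof.
move=> fr fl; rewrite linear_sum.
under eq_bigr => i _ do rewrite linear_sum.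
under eq_bigr => i _ do under eq_bigr => j _ do rewrite linearZ /= ext_mapM !ext_map_vec.
(* The slots are transferred one at a time; here the second slot already uses the dual basis of p',
   the first still that of p. *)
transitivity (\sum_(i < \dim {:V}) \sum_(j < \dim {:V'})
    f (dual_vec p i) (s (dual_vec p' j)) *:
      (ext_vec (P (vbasis {:V})`_i) * ext_vec (vbasis {:V'})`_j)).
  apply: eq_bigr => i _.
  apply: (sum_dual_adjoint (G := fun x u => f _ x *: (_ * ext_vec u))) => // [u|u] a x y.
    by rewrite fr scalerDl scalerA.
  by rewrite linearP mulrDr -scalerAr scalerDr !scalerA mulrC.
apply: (sum_dual_adjoint (G := fun x u => \sum_j f x _ *: (ext_vec u * _))) => // [u|u] a x y;
  rewrite scaler_sumr -big_split; apply: eq_bigr => j _ /=.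
  by rewrite fl scalerDl scalerA.
by rewrite linearP mulrDl -scalerAl scalerDr !scalerA mulrC.
Qed.

Lemma ext_map_form3_sum f :
  (forall x y, scalar (f x y)) -> (forall x z, scalar (fun y => f x y z)) ->
  (forall y z, scalar (fun x => f x y z)) ->
  ext_map P (form3_sum p f) = form3_sum p' (fun x y z => f (s x) (s y) (s z)).
Proof.
move=> f3 f2 f1; rewrite linear_sum.
under eq_bigr => i _ do rewrite linear_sum.
under eq_bigr => i _ do under eq_bigr => j _ do rewrite linear_sum.
under eq_bigr => i _ do under eq_bigr => j _ do
  under eq_bigr => k _ do rewrite linearZ /= !ext_mapM !ext_map_vec.
transitivity (\sum_(i < \dim {:V}) \sum_(j < \dim {:V}) \sum_(k < \dim {:V'})
    f (dual_vec p i) (dual_vec p j) (s (dual_vec p' k)) *: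
      (ext_vec (P (vbasis {:V})`_i) * ext_vec (P (vbasis {:V})`_j) *
       ext_vec (vbasis {:V'})`_k)).
  apply: eq_bigr => i _; apply: eq_bigr => j _.
  apply: (sum_dual_adjoint (G := fun x u => f _ _ x *: (_ * ext_vec u))) => // [u|u] a x y.
    by rewrite f3 scalerDl scalerA.
  by rewrite linearP mulrDr -scalerAr scalerDr !scalerA mulrC.
transitivity (\sum_(i < \dim {:V}) \sum_(j < \dim {:V'}) \sum_(k < \dim {:V'})
    f (dual_vec p i) (s (dual_vec p' j)) (s (dual_vec p' k)) *:
      (ext_vec (P (vbasis {:V})`_i) * ext_vec (vbasis {:V'})`_j *
       ext_vec (vbasis {:V'})`_k)).
  apply: eq_bigr => i _.
  apply: (sum_dual_adjoint (G := fun x u => \sum_k f _ x _ *: (_ * ext_vec u * _)))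
    => // [u|u] a x y; rewrite scaler_sumr -big_split; apply: eq_bigr => k _ /=.
    by rewrite f2 scalerDl scalerA.
  by rewrite linearP mulrDr mulrDl -scalerAr -scalerAl scalerDr !scalerA mulrC.
apply: (sum_dual_adjoint (G := fun x u => \sum_j \sum_k f x _ _ *: (ext_vec u * _ * _)))
  => // [u|u] a x y; rewrite scaler_sumr -big_split; apply: eq_bigr => j _ /=;
  rewrite scaler_sumr -big_split; apply: eq_bigr => k _ /=.
  by rewrite f1 scalerDl scalerA.
by rewrite linearP !mulrDl -!scalerAl scalerDr !scalerA mulrC.
Qed.

Lemma ext_map_mv2 f : 2%:R != 0 :> F ->
  (forall x, scalar (f x)) -> (forall y, scalar (f^~ y)) ->
  (forall x y, f x y = - f y x) ->
  ext_map P (mv2 p f) = mv2 p' (fun x y => f (s x) (s y)).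
Proof.
move=> F2 fr fl fC; apply: (scalerI F2); rewrite !scaler_nat -linearMn /=.
by rewrite !mv2_sum // ext_map_form2_sum.
Qed.

Lemma ext_map_mv3 f : 6%:R != 0 :> F ->
  (forall x y, scalar (f x y)) -> (forall x z, scalar (fun y => f x y z)) ->
  (forall y z, scalar (fun x => f x y z)) ->
  (forall x y z, f x y z = - f y x z) -> (forall x y z, f x y z = - f x z y) ->
  ext_map P (mv3 p f) = mv3 p' (fun x y z => f (s x) (s y) (s z)).
Proof.
move=> F6 f3 f2 f1 fC12 fC23; apply: (scalerI F6); rewrite !scaler_nat -linearMn /=.
by rewrite !mv3_sum // ext_map_form3_sum.
Qed.

End FormAdjoint.

(** * The differential of a 2-form *)

Section LieDifferential.
Variables (F : fieldType) (V W : vectType F) (p : V -> W -> F) (br : W -> W -> W).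
Hypotheses (F6 : 6%:R != 0 :> F) (pp : perfect_pairing p).
Hypothesis brC : forall x y, br x y = - br y x.
Local Notation n := (\dim {:V}).
Local Notation e i := (ext_vec (vbasis {:V})`_i).
Local Notation w i := (dual_vec p i).
Local Notation delta := (fun v => mv2 p (fun x y => - p v (br x y))).

(** Koszul's formula for the differential of a 2-form. With T the sum over all indices of f(x,
    [y, z]), the derivation rule gives 2 D (mv2 f) = T, while the three cyclic terms on the right
    contribute T each to 6 times the right-hand side. Both sides times 6 are thus 3 T. *)
Lemma odd_deriv_mv2 (f : W -> W -> F) :
  (forall x, scalar (f x)) -> (forall x y, f x y = - f y x) ->
  odd_deriv delta (mv2 p f) =
  mv3 p (fun x y z => f x (br y z) + f y (br z x) + f z (br x y)).
Proof.
move=> fr fC; have [pr pl _ _] := pp.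
have ldelta : linear delta.
  apply: (@mv2_linear _ _ _ p _ (fun v x y => - p v (br x y))) => x y a u v.
  by rewrite pl opprD mulrN.
have cdelta v : ext_vec v * delta v = delta v * ext_vec v by exact: mv2_comm.
have delta2 v : delta v *+ 2 = - form2_sum p (fun x y => p v (br x y)).
  rewrite mv2_sum => [|x y]; last by rewrite brC (scalar_funN (pr v)).
  rewrite /form2_sum -sumrN; apply: eq_bigr => i _; rewrite -sumrN.
  by apply: eq_bigr => j _; rewrite scaleNr.
pose T := form3_sum p (fun x y z => f x (br y z)).
have fE i u : \sum_(j < n) f (w i) (w j) * p (vbasis {:V})`_j u = f (w i) u.
  rewrite {2}(dual_expand pp u) (scalar_sumZ (fr _)).
  by apply: eq_bigr => j _; rewrite mulrC.
pose U := \sum_(i < n) \sum_(j < n) f (w i) (w j) *: (e i * delta (vbasis {:V})`_j).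
(* In T the slot [w_k, w_l] is expanded by [fE]; the sum over k and l that remains is -2 delta
   e_j. *)
have U2 : U *+ 2 = - T.
  rewrite /T /form3_sum -sumrN -sumrMnl; apply: eq_bigr => i _.
  under [in RHS]eq_bigr => k _ do
    under eq_bigr => l _ do rewrite -fE scaler_suml.
  under [in RHS]eq_bigr => k _ do rewrite exchange_big.
  rewrite exchange_big -sumrN -sumrMnl; apply: eq_bigr => j _.
  rewrite scalerMnr -mulrnAr delta2 mulrN scalerN; congr (- _).
  rewrite /form2_sum mulr_sumr scaler_sumr; apply: eq_bigr => k _.
  rewrite mulr_sumr scaler_sumr; apply: eq_bigr => l _.
  by rewrite -scalerAr scalerA mulrA.
(* The terms with delta on the first factor add up to -U as well, by exchanging i and j: f changes
   sign and the values of delta commute with vectors. *)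
have D2 : odd_deriv delta (mv2 p f) *+ 2 = T.
  rewrite -linearMn /= mv2_sum // -[T]opprK -U2 linear_sum /=.
  transitivity (\sum_(i < n) \sum_(j < n) f (w i) (w j) *:
      (delta (vbasis {:V})`_i * e j) - U); last first.
    rewrite mulr2n opprD; congr (_ - _); rewrite exchange_big -sumrN.
    apply: eq_bigr => i _; rewrite -sumrN; apply: eq_bigr => j _.
    by rewrite /= fC -mv2_comm scaleNr.
  rewrite -sumrB; apply: eq_bigr => i _; rewrite -sumrB linear_sum /=.
  apply: eq_bigr => j _.
  by rewrite linearZ /= odd_deriv_vecM // odd_deriv_vec // scalerBr.
apply: (scalerI F6); rewrite !scaler_nat mv3_sum; first last.
- move=> x y z; rewrite (brC y z) (brC z x) (brC x y) !(scalar_funN (fr _)).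
  by rewrite -!opprD addrAC.
- move=> x y z; rewrite (brC y z) (brC z x) (brC x y) !(scalar_funN (fr _)).
  by rewrite -!opprD [f y _ + f x _]addrC.
rewrite (mulrnA _ 2 3) D2.
(* A cyclic rotation moves one vector past two others, which costs no sign. *)
have form3_rot f1 : form3_sum p (fun x y z => f1 y z x) = form3_sum p f1.
  rewrite /form3_sum exchange_big; under eq_bigr => j _ do rewrite exchange_big.
  apply: eq_bigr => j _; apply: eq_bigr => k _; apply: eq_bigr => i _.
  by rewrite -mulrA ext_vec2C.
rewrite !form3_sumD (form3_rot (fun x y z => f y (br z x))).
by rewrite (form3_rot (fun x y z => f x (br y z))) mulrSr mulr2n.
Qed.

End LieDifferential.

(** * Exterior powers and evaluation of 3-forms *)

Section ExteriorPower.
Variables (F : fieldType).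
Implicit Types V W : vectType F.

Lemma ext_wedge_pow V (U : {vspace V}) (s : seq V) :
  all (fun v => v \in U) s -> ext_wedge s \in ext_pow U (size s).
Proof.
elim: s => [_|v s IHs /= /andP[Uv /IHs Us]].
  by rewrite ext_wedge_nil /ext_pow expv0 memv_line.
rewrite ext_wedge_cons /ext_pow expvSl memv_mul //.
by apply/memv_imgP; exists v; rewrite ?lfunE.
Qed.

(** Wedges of vectors of U span the power. The subspace [K] is arbitrary so that the induction can
    replace it by its preimage under multiplication by a vector. *)
Lemma ext_pow_sub V (U : {vspace V}) k (K : {vspace exterior V}) :
  (forall s, size s = k -> all (fun v => v \in U) s -> ext_wedge s \in K) ->
  (ext_pow U k <= K)%VS.
Proof.
elim: k K => [|k IHk] K wK.
  by rewrite /ext_pow expv0 -memvE -(ext_wedge_nil V) wK.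
rewrite /ext_pow expvSl; apply/prodvP => _ x /memv_imgP[v Uv ->] Ux.
pose f := linfun (fun y : exterior V => ext_vec v * y).
have fE y : f y = ext_vec v * y.
  by rewrite linfunE // => a u w; rewrite mulrDr -scalerAr.
rewrite lfunE /= -fE memv_preim; apply: (subvP (IHk _ _)) x Ux => s sk Us.
by rewrite -memv_preim fE -ext_wedge_cons wK //= ?sk ?Uv.
Qed.

Lemma ext_pow_eq V (U : {vspace V}) k (X : vectType F) (f h : exterior V -> X) :
  linear f -> linear h ->
  (forall s, size s = k -> all (fun v => v \in U) s -> f (ext_wedge s) = h (ext_wedge s)) ->
  {in ext_pow U k, f =1 h}.
Proof.
move=> lf lh fh x Ux; apply/eqP; rewrite -subr_eq0.
have := subvP (@ext_pow_sub V U k (lker (linfun f - linfun h)%VF) _) _ Ux.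
rewrite memv_ker add_lfunE opp_lfunE !linfunE //; apply=> s sk Us.
by rewrite memv_ker add_lfunE opp_lfunE !linfunE // fh // subrr.
Qed.

Lemma ext_map_pow V W (f : 'Hom(V, W)) (U : {vspace V}) (U' : {vspace W}) k x :
  (f @: U <= U')%VS -> x \in ext_pow U k -> ext_map f x \in ext_pow U' k.
Proof.
move=> fU; rewrite memv_preim; apply/subvP: x; apply: ext_pow_sub => s <- Us.
rewrite -memv_preim ext_map_wedge -(size_map f) ext_wedge_pow // all_map.
by apply: sub_all Us => v Uv /=; apply: (subvP fU); rewrite memv_img.
Qed.

Lemma mv2_pow V W (p : V -> W -> F) f : mv2 p f \in ext_pow {:V} 2.
Proof.
apply: memv_suml => i _; apply: memv_suml => j _; rewrite memvZ //.
by rewrite ext_wedge_pow //= !memvf.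
Qed.

Lemma ext_degree1_linear V : linear (@ext_degree1 F V).
Proof.
move=> a x y; rewrite /ext_degree1 scaler_sumr -big_split; apply: eq_bigr => i _ /=.
by rewrite ext_coordD ext_coordZ scalerDl scalerA.
Qed.
HB.instance Definition _ V :=
  GRing.isLinear.Build F (exterior V) V _ (@ext_degree1 F V) (@ext_degree1_linear V).

Lemma ext_degree1_vec V (v : V) : ext_degree1 (ext_vec v) = v.
Proof.
rewrite [RHS](coord_vbasis (memvf v)) /ext_vec linear_sum; apply: eq_bigr => i _.
rewrite linearZ /=; congr (_ *: _); rewrite /ext_degree1 (bigD1 i) //= big1 ?addr0.
  by rewrite ext_coord_blade eqxx scale1r.
by move=> j neji; rewrite ext_coord_blade (inj_eq set1_inj) (negPf neji) scale0r.
Qed.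

End ExteriorPower.

Section EvaluationForms.
Variables (F : fieldType) (g : vectType F).
Local Notation dual := 'Hom(g, F^o).
Local Notation ev := (fun (xi : dual) (x : g) => xi x : F).

Lemma ev_perfect : perfect_pairing ev.
Proof.
split=> [xi a x y|x a xi zeta|xi xi0|x x0].
- by rewrite linearP.
- by rewrite add_lfunE scale_lfunE.
- by apply/lfunP=> x; rewrite zero_lfunE; exact: xi0.
rewrite (coord_vbasis (memvf x)) big1 // => i _.
have := x0 (linfun (coord (vbasis {:g}) i : g -> F^o)).
rewrite linfunE => [->|]; first by rewrite scale0r.
exact: coord_is_scalar.
Qed.

Lemma contraction_vecM (A : g) (alpha : dual) x :
  contraction A (ext_vec alpha * x) = (alpha A : F) *: x - ext_vec alpha * contraction A x.
Proof.
rewrite odd_deriv_vecM => [|a u v|v]; rewrite ?mulr_algl ?mulr_algr //.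
by rewrite add_lfunE scale_lfunE scalerDl scalerA.
Qed.

Lemma contraction_vec (A : g) (alpha : dual) :
  contraction A (ext_vec alpha) = (alpha A : F)%:A.
Proof.
rewrite -[ext_vec _]mulr1 contraction_vecM /contraction odd_deriv1 ?mulr0 ?subr0 //.
- by move=> a u v; rewrite add_lfunE scale_lfunE scalerDl scalerA.
- by move=> v; rewrite mulr_algl mulr_algr.
Qed.

(** The order of contractions is that of the twisting term of [double_bracket], whose value at z is
    then [eval3 H x y z] when x and y are the first components of the arguments. *)
Definition eval2 (H : exterior dual) (y z : g) : F := ext_degree1 (contraction y H) z.
Definition eval3 (H : exterior dual) (x y z : g) : F := eval2 (contraction x H) y z.

Lemma eval2_linear y z : scalar (fun H => eval2 H y z).
Proof. by move=> a u v; rewrite /eval2 !linearP add_lfunE scale_lfunE. Qed.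

Lemma eval3_linear x y z : scalar (fun H => eval3 H x y z).
Proof. by move=> a u v; rewrite /eval3 linearP eval2_linear. Qed.

Lemma contraction_wedge2 (t : g) (u v : dual) : contraction t (ext_vec u * ext_vec v) =
  (u t : F) *: ext_vec v - (v t : F) *: ext_vec u.
Proof. by rewrite contraction_vecM contraction_vec mulr_algr. Qed.

Lemma eval2_wedge (u v : dual) y z :
  eval2 (ext_vec u * ext_vec v) y z = (u y : F) * (v z : F) - (v y : F) * (u z : F).
Proof.
rewrite /eval2 contraction_wedge2 linearB /= add_lfunE opp_lfunE.
by rewrite !linearZ /= !ext_degree1_vec !scale_lfunE.
Qed.

(** The determinant of the values of a, b, c at x, y, z, expanded along x. *)
Lemma eval3_wedge (a b c : dual) x y z :
  eval3 (ext_vec a * ext_vec b * ext_vec c) x y z =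
    (a x : F) * ((b y : F) * (c z : F) - (c y : F) * (b z : F))
    - ((b x : F) * ((a y : F) * (c z : F) - (c y : F) * (a z : F))
    - (c x : F) * ((a y : F) * (b z : F) - (b y : F) * (a z : F))).
Proof.
rewrite /eval3 -mulrA contraction_vecM contraction_wedge2 mulrBr -!scalerAr.
rewrite !(scalar_funB (eval2_linear _ _)) !(scalar_funZ (eval2_linear _ _)).
by rewrite !eval2_wedge.
Qed.

Section DegreeThree.
Variables (U : {vspace dual}) (H : exterior dual).
Hypothesis UH : H \in ext_pow U 3.

Lemma eval3_eq (f h : exterior dual -> F) : scalar f -> scalar h ->
  (forall a b c, a \in U -> b \in U -> c \in U ->
    f (ext_vec a * ext_vec b * ext_vec c) = h (ext_vec a * ext_vec b * ext_vec c)) ->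
  f H = h H.
Proof.
move=> sf sh fh.
have fhw s : size s = 3 -> all (fun v => v \in U) s -> f (ext_wedge s) = h (ext_wedge s).
  case: s => [|a [|b [|c []]]] //= _.
  by case/and4P=> Ua Ub Uc _; rewrite ext_wedge3 fh.
exact: (@ext_pow_eq _ _ U 3 F^o f h sf sh fhw H UH).
Qed.

Lemma eval3_swap12 x y z : eval3 H x y z = - eval3 H y x z.
Proof.
apply: (@eval3_eq (fun H => eval3 H x y z) (fun H => - eval3 H y x z)) => [|a u v|a b c _ _ _].
- exact: eval3_linear.
- by rewrite eval3_linear opprD mulrN.
- by rewrite !eval3_wedge; ring.
Qed.

Lemma eval3_swap23 x y z : eval3 H x y z = - eval3 H x z y.
Proof.
apply: (@eval3_eq (fun H => eval3 H x y z) (fun H => - eval3 H x z y)) => [|a u v|a b c _ _ _].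
- exact: eval3_linear.
- by rewrite eval3_linear opprD mulrN.
- by rewrite !eval3_wedge; ring.
Qed.

Lemma eval3_scalar3 x y : scalar (eval3 H x y).
Proof. by move=> a z z'; rewrite /eval3 /eval2 linearP. Qed.

End DegreeThree.

Lemma form3_sum_tensor (a b c : dual) :
  form3_sum ev (fun x y z => (a x : F) * (b y : F) * (c z : F)) =
  ext_vec a * ext_vec b * ext_vec c.
Proof.
have vecE (v : dual) : ext_vec v = \sum_(i < \dim {:dual})
    (v (dual_vec ev i) : F) *: ext_vec (vbasis {:dual})`_i.
  by rewrite {1}(basis_expand ev_perfect v) linear_sum; apply: eq_bigr => i _; rewrite linearZ.
rewrite (vecE a) (vecE b) (vecE c) -mulrA mulr_suml; apply: eq_bigr => i _.
rewrite mulr_suml mulr_sumr; apply: eq_bigr => j _.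
rewrite mulrA [RHS]mulr_sumr; apply: eq_bigr => k _.
rewrite -!(scalerAl, scalerAr) !scalerA; congr (_ *: _); ring.
Qed.

(** By linearity H may be taken to be a product a b c. Each of the six signed tensors in the
    determinant of [eval3_wedge] then contributes that same product after reordering, which accounts
    for the factor 6. *)
Lemma mv3_eval3 H : 6%:R != 0 :> F -> H \in ext_pow {:dual} 3 -> mv3 ev (eval3 H) = H.
Proof.
move=> F6 H3; apply: (scalerI F6); rewrite !scaler_nat mv3_sum; first last.
- exact: eval3_swap23 H3.
- exact: eval3_swap12 H3.
have form3_linear : linear (fun H => form3_sum ev (eval3 H)).
  by move=> a u v; rewrite -form3_sum_lincomb; apply: eq_form3_sum => x y z; exact: eval3_linear.
have muln6_linear : linear (fun H : exterior dual => H *+ 6).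
  by move=> a u v; rewrite mulrnDl scalerMnr.
apply: (ext_pow_eq form3_linear muln6_linear _ H3).
case=> [|a [|b [|c []]]] //= _ _; rewrite ext_wedge3.
pose T (a b c : dual) x y z : F := (a x : F) * (b y : F) * (c z : F).
transitivity (form3_sum ev (T a b c) - form3_sum ev (T a c b) - form3_sum ev (T b a c)
    + form3_sum ev (T b c a) + form3_sum ev (T c a b) - form3_sum ev (T c b a)).
  rewrite -!(form3_sumB, form3_sumD); apply: eq_form3_sum => x y z.
  by rewrite eval3_wedge /T; ring.
rewrite !form3_sum_tensor.
have C12 (u v w : dual) :
    ext_vec u * ext_vec v * ext_vec w = - (ext_vec v * ext_vec u * ext_vec w).
  by rewrite (ext_vecC u) mulNr.
have C23 (u v w : dual) :
    ext_vec u * ext_vec v * ext_vec w = - (ext_vec u * ext_vec w * ext_vec v).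
  by rewrite -!mulrA (ext_vecC v) mulrN.
rewrite (C12 b a c) (C23 a c b) (C23 b c a) (C12 b a c).
rewrite (C12 c a b) (C12 c b a) (C23 a c b) (C23 b c a) (C12 b a c) !opprK.
by rewrite !mulrS mulr0n addr0 !addrA.
Qed.

End EvaluationForms.

Lemma qproj_eq0 (F : fieldType) (g : vectType F) (I : {vspace g}) x :
  (qproj I x == 0) = (x \in I).
Proof. by rewrite -memv_ker lker_qproj. Qed.

Lemma annihilator_factor (F : fieldType) (g : vectType F) (I : {vspace g})
    (alpha : 'Hom(g, F^o)) : alpha \in annihilator I ->
  (alpha \o (qproj I)^-1 \o qproj I)%VF = alpha.
Proof.
move=> /annihilatorP aI; apply/lfunP => x; rewrite !comp_lfunE.
apply/eqP; rewrite -subr_eq0 -linearB; apply/eqP/aI.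
by rewrite -qproj_eq0 linearB /= limg_lfunVK ?subrr // limg_qproj memvf.
Qed.

(** * Forms on g/I as forms on g *)

Section Pullback.
Variables (F : fieldType) (g : vectType F) (I : {vspace g}).
Local Notation q := (qproj I).
Local Notation dualq := 'Hom(quotv I, F^o).

Let fstar (alpha : dualq) : 'Hom(g, F^o) := (alpha \o q)%VF.
Let fstar_linear : linear fstar.
Proof. by move=> a u v; rewrite /fstar comp_lfunDl comp_lfunZl. Qed.

Lemma pullback_inj : injective (pullback q).
Proof.
apply: ext_map_inj; rewrite -subv0; apply/subvP => alpha.
rewrite memv_ker memv0 (linfunE fstar_linear) => /eqP a0.
apply/eqP/lfunP => u; have : u \in limg q by rewrite limg_qproj memvf.
by case/memv_imgP => x _ ->; rewrite -comp_lfunE -/(fstar alpha) a0 !zero_lfunE.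
Qed.

(** Passes the degree from a pullback down to the form on g/I: forms that annihilate I factor
    through g/I, so the pullback of H is also the pullback of some element of degree k, and
    injectivity identifies that element with H. *)
Lemma pullback_pow k (H : exterior dualq) :
  pullback q H \in ext_pow (annihilator I) k -> H \in ext_pow {:dualq} k.
Proof.
move=> HI; have : pullback q H \in (pullback q @: ext_pow {:dualq} k)%VS.
  apply: subvP HI; apply: ext_pow_sub => s sk sI.
  pose t := map (fun alpha : 'Hom(g, F^o) => (alpha \o q^-1)%VF) s.
  have -> : ext_wedge s = pullback q (ext_wedge t).
    rewrite ext_map_wedge -map_comp -{1}(map_id s); congr ext_wedge.
    apply/eq_in_map => alpha /(allP sI) Ialpha /=.
    by rewrite (linfunE fstar_linear) /fstar annihilator_factor.
  rewrite memv_img // -sk -(size_map (fun alpha : 'Hom(g, F^o) => (alpha \o q^-1)%VF) s).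
  by rewrite ext_wedge_pow //; apply/allP => ? _; exact: memvf.
by case/memv_imgP => H' H'k /pullback_inj ->.
Qed.

Lemma eval3_pullback (H : exterior dualq) x y z :
  H \in ext_pow {:dualq} 3 ->
  eval3 (pullback q H) x y z = eval3 H (q x) (q y) (q z).
Proof.
move=> H3; have l1 : scalar (fun H : exterior dualq => eval3 (pullback q H) x y z).
  by move=> a u v; rewrite linearP eval3_linear.
apply: (eval3_eq H3 l1 (eval3_linear _ _ _)) => a b c _ _ _.
by rewrite !ext_mapM !ext_map_vec !eval3_wedge !(linfunE fstar_linear) !comp_lfunE.
Qed.

End Pullback.

(** * The double and its lagrangian subspaces *)

(** Used to obtain the embedding of g/I into M from the projection of L to the dual of g/I. The
    adjunction on basis vectors prescribes the coefficients of [s w']. *)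
Lemma adjoint_exists (F : fieldType) (V W V' W' : vectType F) (p : V -> W -> F)
    (p' : V' -> W' -> F) (P : 'Hom(V, V')) :
  perfect_pairing p -> (forall w', scalar (p'^~ w')) ->
  exists s : W' -> W, forall v w', p v (s w') = p' (P v) w'.
Proof.
move=> pp p'l; have [pr _ _ _] := pp.
exists (fun w' => \sum_(i < \dim {:V}) p' (P (vbasis {:V})`_i) w' *: dual_vec p i).
move=> v w'; rewrite (scalar_sumZ (pr v)) [in RHS](basis_expand pp v) linear_sum.
under [in RHS]eq_bigr => i _ do rewrite linearZ /=.
by rewrite (scalar_sumZ (p'l w')); apply: eq_bigr => i _; rewrite mulrC.
Qed.

Lemma lie_bracketC (F : fieldType) (V : vectType F) (br : V -> V -> V) :
  is_lie_bracket br -> forall x y, br x y = - br y x.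
Proof.
move=> [brr brl alt _] x y.
have brD u v w : br (u + v) w = br u w + br v w by have := brl w 1 u v; rewrite !scale1r.
have brDr u v w : br w (u + v) = br w u + br w v by have := brr w 1 u v; rewrite !scale1r.
by apply/eqP; rewrite -addr_eq0; have := alt (x + y); rewrite brD !brDr !alt add0r addr0 => ->.
Qed.

Section DoublePairing.
Variables (F : fieldType) (g : vectType F).
Local Notation E := (g * 'Hom(g, F^o))%type.
Local Notation pair := (double_pair g).

Lemma double_pairC (u v : E) : pair u v = pair v u.
Proof. exact: addrC. Qed.

Lemma double_pair_scalarr (u : E) : scalar (pair u).
Proof.
move=> a v w; rewrite /double_pair /= linearP add_lfunE scale_lfunE /=.
by rewrite mulrDr addrACA.
Qed.

Lemma double_pair_scalarl (v : E) : scalar (pair^~ v).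
Proof. by move=> a u w; rewrite !(double_pairC _ v) double_pair_scalarr. Qed.

Lemma double_pair_nondeg (u : E) : (forall v, pair u v = 0) -> u = 0.
Proof.
move=> u0; have [_ _ _ ev_nd] := ev_perfect g.
rewrite [u]surjective_pairing; congr Datatypes.pair.
  by apply: ev_nd => alpha; have := u0 (0, alpha); rewrite /double_pair /= linear0 add0r.
apply/lfunP => x; have := u0 (x, 0); rewrite /double_pair /= !zero_lfunE addr0.
exact.
Qed.

Lemma mem_ideal_double (I : {vspace g}) (u : E) :
  (u \in ideal_double I) = (u.1 \in I) && (u.2 \in annihilator I).
Proof.
have l1 : linear (fun A : g => (A, 0) : E).
  by move=> a x y; congr Datatypes.pair; rewrite /= scaler0 addr0.
have l2 : linear (fun alpha : 'Hom(g, F^o) => (0, alpha) : E).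
  by move=> a x y; congr Datatypes.pair; rewrite /= scaler0 addr0.
apply/memv_addP/andP => [[_ /memv_imgP[A IA ->] [_ /memv_imgP[alpha Ia ->] ->]]|[IA Ia]].
  by rewrite !linfunE //= addr0 add0r.
exists (u.1, 0); first by apply/memv_imgP; exists u.1; rewrite ?linfunE.
exists (0, u.2); first by apply/memv_imgP; exists u.2; rewrite ?linfunE.
by rewrite [LHS]surjective_pairing; congr Datatypes.pair; rewrite /= ?addr0 ?add0r.
Qed.

(** Forms on g/I separate its points, and their compositions with [qproj I] annihilate I. *)
Lemma annihilator_annihilator (I : {vspace g}) x :
  (forall alpha, alpha \in annihilator I -> alpha x = 0) -> x \in I.
Proof.
move=> x0; rewrite -qproj_eq0; apply/eqP.
have [_ _ _ ev_nd] := ev_perfect (quotv I); apply: ev_nd => alpha.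
rewrite -comp_lfunE x0 //; apply/annihilatorP => y Iy.
by rewrite comp_lfunE (eqP (_ : qproj I y == 0)) ?linear0 // qproj_eq0.
Qed.

Lemma lagrangian_ideal_double (I : {vspace g}) : lagrangian pair (ideal_double I).
Proof.
move=> u; split=> [|u0].
  rewrite mem_ideal_double => /andP[Iu /annihilatorP au] v.
  rewrite mem_ideal_double => /andP[Iv /annihilatorP av].
  by rewrite /double_pair au // av // addr0.
rewrite mem_ideal_double; apply/andP; split.
  apply: annihilator_annihilator => alpha Ia.
  have := u0 (0, alpha); rewrite mem_ideal_double /double_pair /= mem0v Ia => /(_ isT).
  by rewrite linear0 add0r.
apply/annihilatorP => x Ix; have := u0 (x, 0).
by rewrite mem_ideal_double /double_pair /= mem0v Ix zero_lfunE addr0 => /(_ isT).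
Qed.

End DoublePairing.

Section RestrictedPairing.
Variables (F : fieldType) (E : vectType F) (pair : E -> E -> F).
Hypotheses (pair_scalarr : forall u, scalar (pair u))
  (pairC : forall u v, pair u v = pair v u)
  (pair_nondeg : forall u, (forall v, pair u v = 0) -> u = 0).

(** A vector of L is orthogonal to L already; if it is orthogonal to M too, it is orthogonal to E.
    The same holds with L and M exchanged. *)
Lemma restr_pair_perfect (L M : {vspace E}) :
  lagrangian pair L -> lagrangian_complement pair L M ->
  perfect_pairing (restr_pair pair (L := L) (M := M)).
Proof.
move=> lagL [lagM [LM _]].
have dec v : exists l m, [/\ l \in L, m \in M & v = l + m].
  have : v \in (L + M)%VS by rewrite LM memvf.
  by case/memv_addP => l Ll [m Mm ->]; exists l, m.
split=> [l a u v|m a u v|l l0|m m0].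
- by rewrite /restr_pair linearP pair_scalarr.
- by rewrite /restr_pair linearP /= !(pairC _ (vsval m)) pair_scalarr.
- apply/val_inj/pair_nondeg => v; have [l' [m [Ll' Mm ->]]] := dec v.
  rewrite (scalar_funD (pair_scalarr _)) (lagL _).1 ?subvsP // add0r.
  by have := l0 (vsproj M m); rewrite /restr_pair vsprojK.
apply/val_inj/pair_nondeg => v; have [l [m' [Ll Mm' ->]]] := dec v.
rewrite (scalar_funD (pair_scalarr _)) [X in _ + X](lagM _).1 ?subvsP // addr0.
by have := m0 (vsproj L l); rewrite /restr_pair vsprojK // pairC.
Qed.

End RestrictedPairing.

(** * Projection to the quotient *)

Lemma eq_mv2 (F : fieldType) (V W : vectType F) (p : V -> W -> F) f1 f2 :
  (forall x y, f1 x y = f2 x y) -> mv2 p f1 = mv2 p f2.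
Proof. by move=> ef; apply: eq_bigr => i _; apply: eq_bigr => j _; rewrite ef. Qed.

Lemma eq_mv3 (F : fieldType) (V W : vectType F) (p : V -> W -> F) f1 f2 :
  (forall x y z, f1 x y z = f2 x y z) -> mv3 p f1 = mv3 p f2.
Proof.
move=> ef; apply: eq_bigr => i _; apply: eq_bigr => j _; apply: eq_bigr => k _.
by rewrite ef.
Qed.

Lemma mv3D (F : fieldType) (V W : vectType F) (p : V -> W -> F) f1 f2 :
  mv3 p (fun x y z => f1 x y z + f2 x y z) = mv3 p f1 + mv3 p f2.
Proof.
rewrite /mv3 -big_split; apply: eq_bigr => i _; rewrite -big_split.
apply: eq_bigr => j _; rewrite -big_split; apply: eq_bigr => k _.
by rewrite scalerDl.
Qed.

Lemma ext_map_schouten_span (F : fieldType) (V W : vectType F) (br : V -> V -> V)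
    (P : 'Hom(V, W)) :
  (forall u v, P (br u v) = 0) -> (schouten_span br <= lker (ext_map P))%VS.
Proof.
move=> P0; apply/schouten_spanP => x y; rewrite memv_ker; apply/eqP.
rewrite linear_sum big1 // => S _; rewrite linear_sum big1 // => T _.
rewrite linearZ /= linear_sum big1 ?scaler0 // => i _.
rewrite linear_sum big1 // => j _.
by rewrite linearZ /= ext_map_wedge /= ext_wedge_cons P0 linear0 mul0r scaler0.
Qed.

(* dbr stands for double_bracket br H, and eta for the 3-form Htilde on g/I. *)
Section TwistedDouble.
Variables (F : fieldType) (g : vectType F) (br : g -> g -> g) (I : {vspace g}).
Local Notation q := (qproj I).
Local Notation dualq := 'Hom(quotv I, F^o).
Local Notation E := (g * 'Hom(g, F^o))%type.
Local Notation pair := (double_pair g).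
Local Notation L := (ideal_double I).
Local Notation brq := (quot_bracket br I).
Variables (dbr : E -> E -> E) (eta : quotv I -> quotv I -> quotv I -> F).
Hypotheses (F6 : 6%:R != 0 :> F) (lie_br : is_lie_bracket br) (idI : is_ideal br I).
Hypotheses (eta_swap12 : forall x y z, eta x y z = - eta y x z)
  (eta_swap23 : forall x y z, eta x y z = - eta x z y)
  (eta_scalar : forall x y, scalar (eta x y)).
Hypothesis dbr1 : forall u v, (dbr u v).1 = br u.1 v.1.
Hypothesis pair_dbr : forall u v w, pair (dbr u v) w =
  (w.2 (br u.1 v.1) : F) - (v.2 (br u.1 w.1) : F) + (u.2 (br v.1 w.1) : F)
    + eta (q u.1) (q v.1) (q w.1).

Let brC := lie_bracketC lie_br.

Let pair_dbr_swap12 (u v w : E) : pair (dbr u v) w = - pair (dbr v u) w.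
Proof.
rewrite !pair_dbr eta_swap12.
have -> : w.2 (br v.1 u.1) = - w.2 (br u.1 v.1) by rewrite brC linearN.
ring.
Qed.

(** Invariance of the pairing under the bracket. Together with [pair_dbr_swap12] it carries
    linearity from the last slot to the other two. *)
Let pair_dbr_swap23 (u v w : E) : pair (dbr u v) w = - pair (dbr u w) v.
Proof.
rewrite !pair_dbr eta_swap23.
have -> : u.2 (br w.1 v.1) = - u.2 (br v.1 w.1) by rewrite brC linearN.
ring.
Qed.

Let pair_dbr_scalar3 u v : scalar (pair (dbr u v)).
Proof. exact: double_pair_scalarr. Qed.

Let pair_dbr_scalar2 u w : scalar (fun v => pair (dbr u v) w).
Proof.
by move=> a v v'; rewrite !(pair_dbr_swap23 u _ w) pair_dbr_scalar3 opprD mulrN.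
Qed.

Let pair_dbr_scalar1 v w : scalar (fun u => pair (dbr u v) w).
Proof.
by move=> a u u'; rewrite !(pair_dbr_swap12 _ v w) pair_dbr_scalar2 opprD mulrN.
Qed.

Let eta0 x y : eta x y 0 = 0.
Proof. exact: scalar_fun0 (eta_scalar _ _). Qed.

Let ann0 (alpha : 'Hom(g, F^o)) x : alpha \in annihilator I -> x \in I -> alpha x = 0.
Proof. by move/annihilatorP; apply. Qed.

(** Tested on the vectors (x, 0): the terms with v.2 and u.2 vanish because I is an ideal, the twist
    because v.1 has class zero. The brackets of L therefore lie in I, which serves both for closure
    of L and for the vanishing of the projection on them. *)
Let dbr_ideal (u v : E) : u \in L -> v \in L -> (dbr u v).2 = 0.
Proof.
rewrite !mem_ideal_double => /andP[Iu au] /andP[Iv av]; apply/lfunP => x.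
have := pair_dbr u v (x, 0).
rewrite /double_pair /= !zero_lfunE addr0 => ->.
rewrite (ann0 av) ?(ann0 au) ?(brC _ x) ?memvN ?idI // subrr add0r.
have /eqP-> : q v.1 == 0 by rewrite qproj_eq0.
by rewrite eta_swap23 eta0 oppr0 add0r.
Qed.

Lemma dirac_ideal_double : dirac pair dbr L.
Proof.
split=> [|u v Lu Lv]; first exact: lagrangian_ideal_double.
rewrite mem_ideal_double dbr_ideal // mem0v andbT dbr1.
by move: Lv; rewrite mem_ideal_double => /andP[Iv _]; exact: idI.
Qed.

Lemma qprojE x : q x = qpi I x.
Proof. exact: lfunE. Qed.

Lemma quot_bracketC x y : brq x y = - brq y x.
Proof. by rewrite /quot_bracket brC -!qprojE linearN. Qed.

Lemma annihilator_qrepr (alpha : 'Hom(g, F^o)) x :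
  alpha \in annihilator I -> alpha (qrepr (q x)) = alpha x.
Proof.
move=> Ia; apply/eqP; rewrite -subr_eq0 -linearB; apply/eqP/(ann0 Ia).
by rewrite -qpi_eq qreprK qprojE.
Qed.

Lemma annihilator_qrepr_scalar (alpha : 'Hom(g, F^o)) :
  alpha \in annihilator I -> scalar (fun x : quotv I => alpha (qrepr x) : F).
Proof.
move=> Ia a x y; rewrite -[x]qreprK -[y]qreprK -!qprojE -linearP /=.
by rewrite !annihilator_qrepr // linearP.
Qed.

(** The projection of I + I^0 to I^0, read as the dual of g/I. By [annihilator_qrepr] the choice of
    representative is immaterial, whence the linearity in x that [curry_hom] relies on. *)
Definition ideal_double_proj : 'Hom(subvs_of L, dualq) :=
  curry_hom (fun (l : subvs_of L) (x : quotv I) => (vsval l).2 (qrepr x) : F).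
Local Notation P := ideal_double_proj.

Lemma ideal_double_annihilator (l : subvs_of L) : (vsval l).2 \in annihilator I.
Proof. by have := subvsP l; rewrite mem_ideal_double => /andP[]. Qed.

Lemma ideal_double_projE l x : P l x = (vsval l).2 (qrepr x).
Proof.
apply: curry_homE => [l'|x' a u v]; first exact/annihilator_qrepr_scalar/ideal_double_annihilator.
by rewrite linearP /= add_lfunE scale_lfunE.
Qed.

(** * A lagrangian complement seen from g/I *)

Section Complement.
Variables (M : {vspace E}) (lagM : lagrangian_complement pair L M).
Local Notation p := (restr_pair pair (L := L) (M := M)).
Local Notation ev := (fun (xi : dualq) (x : quotv I) => xi x : F).

Let pp : perfect_pairing p.
Proof.
apply: restr_pair_perfect lagM; last exact: lagrangian_ideal_double.
- exact: double_pair_scalarr.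
- exact: double_pairC.
- exact: double_pair_nondeg.
Qed.

Section Adjoint.
Variable s : quotv I -> subvs_of M.
Hypothesis adj : forall l x, p l (s x) = P l x.

(** By [adj], s x and ([qrepr x], 0) have the same pairing with all of L, so their difference lies
    in L, which equals its orthogonal. *)
Lemma adjoint_ideal x :
  q (vsval (s x)).1 = x /\ (vsval (s x)).2 \in annihilator I.
Proof.
set m := vsval (s x).
have : m - (qrepr x, 0) \in L.
  apply/lagrangian_ideal_double => l Ll.
  rewrite (scalar_funB (double_pair_scalarl l)) double_pairC.
  have := adj (vsproj L l) x; rewrite /restr_pair vsprojK // => ->.
  by rewrite ideal_double_projE vsprojK // /double_pair /= zero_lfunE add0r subrr.
rewrite mem_ideal_double /= subr0 -qpi_eq qreprK -qprojE => /andP[/eqP].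
by [].
Qed.

Let s1 x := (adjoint_ideal x).1.
Let s2 x := (adjoint_ideal x).2.

(** Evaluating at the lift (s y).1 rather than at [qrepr y] makes [omC] the very equation <s x, s y>
    = 0. *)
Let om (x y : quotv I) : F := (vsval (s x)).2 (vsval (s y)).1.

Let om_qrepr x y : om x y = (vsval (s x)).2 (qrepr y).
Proof. by rewrite -[in RHS](s1 y) annihilator_qrepr. Qed.

Let om_scalar x : scalar (om x).
Proof.
by move=> a y z; rewrite !om_qrepr (annihilator_qrepr_scalar (s2 x)).
Qed.

Let omC x y : om x y = - om y x.
Proof.
have [lM _] := lagM; have := (lM (vsval (s x))).1 (subvsP _) _ (subvsP (s y)).
by rewrite /double_pair -/(om x y) -/(om y x) => /eqP; rewrite addr_eq0 => /eqP.
Qed.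

Let brs x y : brq x y = q (br (vsval (s x)).1 (vsval (s y)).1).
Proof. by rewrite -{1}(s1 x) -{1}(s1 y) !qprojE quot_bracketE. Qed.

Let om_br x y z : (vsval (s x)).2 (br (vsval (s y)).1 (vsval (s z)).1) = om x (brq y z).
Proof. by rewrite om_qrepr brs annihilator_qrepr. Qed.

(** The degree one case of pi d_M = d pi, up to sign. As the first component of l lies in the ideal
    I, every term containing it vanishes, and only the second component of l, applied to the bracket
    of the lifts, survives. *)
Lemma pair_adjoint_bracket l x y :
  pair (vsval l) (dbr (vsval (s x)) (vsval (s y))) = P l (brq x y).
Proof.
rewrite double_pairC pair_dbr ideal_double_projE brs.
rewrite annihilator_qrepr ?ideal_double_annihilator //.
have := subvsP l; rewrite mem_ideal_double => /andP[Il _].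
have /eqP-> : q (vsval l).1 == 0 by rewrite qproj_eq0.
by rewrite eta0 !(ann0 (s2 _)) ?idI // subr0 !addr0.
Qed.

Lemma ext_map_d_compl x :
  ext_map P (d_compl pair dbr L M x) = ce_diff brq (ext_map P x).
Proof.
apply: ext_map_odd_deriv => [|w|l].
- apply: (@mv2_linear _ _ _ ev dualq (fun alpha x y => - (alpha (brq x y) : F))) => x1 y1 a u v.
  by rewrite add_lfunE scale_lfunE opprD mulrN.
- exact: mv2_comm.
rewrite (ext_map_mv2 pp (ev_perfect (quotv I)) adj).
- by apply: eq_mv2 => x1 y1; rewrite pair_adjoint_bracket.
- by apply/eqP => F2; case/eqP: F6; rewrite (natrM _ 2 3) F2 mul0r.
- move=> m a u v; rewrite !(double_pairC (vsval l)) linearP.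
  by rewrite pair_dbr_scalar2 opprD mulrN.
- move=> m a u v; rewrite !(double_pairC (vsval l)) linearP.
  by rewrite pair_dbr_scalar1 opprD mulrN.
- by move=> m m'; rewrite !(double_pairC (vsval l)) pair_dbr_swap12.
Qed.

(** By naturality the left side is the form <[s x, s y], s z>. Its untwisted part is om(z, [x, y]) -
    om(y, [x, z]) + om(x, [y, z]), the cyclic sum of [odd_deriv_mv2]. *)
Lemma ext_map_N_compl :
  ext_map P (N_compl pair dbr L M) =
  ce_diff brq (mv2 ev om) + mv3 ev eta.
Proof.
rewrite (ext_map_mv3 pp (ev_perfect (quotv I)) adj) //; first last.
- by move=> y z a u v; rewrite linearP pair_dbr_scalar1.
- by move=> y z a u v; rewrite linearP pair_dbr_scalar2.
- by move=> y z a u v; rewrite linearP pair_dbr_scalar3.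
rewrite /ce_diff (odd_deriv_mv2 F6 (ev_perfect _) quot_bracketC om_scalar omC).
rewrite -mv3D; apply: eq_mv3 => x y z.
rewrite pair_dbr !om_br !s1; congr (_ + _).
by rewrite (quot_bracketC x z) (scalar_funN (om_scalar _)) opprK [RHS]addrC
  [X in _ = _ + X]addrC addrA.
Qed.

End Adjoint.

Lemma obstruction_class_eq0 :
  obstruction_class pair dbr L M = 0 -> ce_class brq 3 (mv3 ev eta) = 0.
Proof.
have [s adj] := adjoint_exists P pp (fun x => let: And4 _ l _ _ := ev_perfect (quotv I) in l x).
pose B := schouten_span (restr_bracket dbr (L := L)).
have P_br : (B <= lker (ext_map P))%VS.
  apply: ext_map_schouten_span => l l'; apply/lfunP => x.
  rewrite ideal_double_projE zero_lfunE vsprojK; last first.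
    by apply: dirac_ideal_double.2; exact: subvsP.
  by rewrite dbr_ideal ?zero_lfunE //; exact: subvsP.
(* Hence [ext_map P] factors through the quotient by brackets. *)
have P_eq y z : qproj B y = qproj B z -> ext_map P y = ext_map P z.
  move/eqP; rewrite -subr_eq0 -linearB qproj_eq0 => /(subvP P_br).
  by rewrite memv_ker linearB subr_eq0 => /eqP.
move/eqP; rewrite cohomology_class_eq0 => /memv_imgP[_ /memv_imgP[z z2 ->]].
rewrite !comp_lfunE => /P_eq; rewrite (ext_map_d_compl adj) (ext_map_N_compl adj).
(* [d_ab] applies [d_compl] to the representative z' picked by the section, which may differ from z
   and need not have degree 2. Their images under [ext_map P] agree, and that of z has degree 2. *)
set z' := (_^-1)%VF _; have zE : qproj B z' = qproj B z.
  by rewrite limg_lfunVK // limg_qproj memvf.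
rewrite (P_eq _ _ zE).
(* The form given by eta is thus d of the image of z minus omega. *)
move/(canRL (addKr _)); rewrite addrC -linearB /= => HE.
have : cohomology_class (ce_diff brq) (ext_pow {:dualq}) 3 (mv3 ev eta) == 0.
  rewrite cohomology_class_eq0 HE memv_img // memvB ?mv2_pow //.
  by apply: ext_map_pow z2; exact: subvf.
by move/eqP.
Qed.

End Complement.

Lemma dirac_complement_N_compl (M : {vspace E}) :
  dirac pair dbr M ->
  N_compl pair dbr L M = 0.
Proof.
move=> [lagM brM]; rewrite /N_compl /mv3.
apply: big1 => i _; apply: big1 => j _; apply: big1 => k _.
by rewrite (lagM _).1 ?scale0r ?brM ?subvsP.
Qed.

End TwistedDouble.

Lemma pair_double_bracket (F : fieldType) (g : vectType F) (br : g -> g -> g)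
    (H : exterior 'Hom(g, F^o)) u v w : is_lie_bracket br ->
  double_pair g (double_bracket br H u v) w =
  (w.2 (br u.1 v.1) : F) - (v.2 (br u.1 w.1) : F) + (u.2 (br v.1 w.1) : F)
    + eval3 H u.1 v.1 w.1.
Proof.
move=> [brr _ _ _].
rewrite /double_pair /double_bracket /lie_deriv /= !add_lfunE !opp_lfunE !comp_lfunE.
rewrite !(linfunE (brr _)) /eval3 /eval2; ring.
Qed.

Theorem proposition5p6 (R : realType) (g : vectType R) (br : g -> g -> g)
    (I : {vspace g}) (H : exterior 'Hom(g, R^o))
    (Htilde : exterior 'Hom(quotv I, R^o)) :
  is_lie_bracket br ->
  is_ideal br I ->
  H \in ext_pow (annihilator I) 3 ->
  ce_diff br H = 0 ->
  pullback (qproj I) Htilde = H ->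
  ce_class (quot_bracket br I) 3 Htilde != 0 ->
  let L := ideal_double I in
  [/\ dirac (double_pair g) (double_bracket br H) L,
      forall M, lagrangian_complement (double_pair g) L M ->
        obstruction_class (double_pair g) (double_bracket br H) L M != 0
    & ~ exists M,
        dirac_complement (double_pair g) (double_bracket br H) L M].
Proof.
move=> lie_br idI HI _ HE; rewrite -{}HE in HI * => nzH L.
have F6 : 6%:R != 0 :> R by rewrite Num.Theory.pnatr_eq0.
have Ht3 := pullback_pow HI.
have swap12 := eval3_swap12 Ht3; have swap23 := eval3_swap23 Ht3.
have scal3 := eval3_scalar3 Htilde.
set dbr := double_bracket br _.
have dbr1 u v : (dbr u v).1 = br u.1 v.1 by [].
(* H is a pullback, so its values depend only on the classes in g/I. *)
have pair_dbr u v w : double_pair g (dbr u v) w =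
    (w.2 (br u.1 v.1) : R) - (v.2 (br u.1 w.1) : R) + (u.2 (br v.1 w.1) : R)
      + eval3 Htilde (qproj I u.1) (qproj I v.1) (qproj I w.1).
  by rewrite -(eval3_pullback _ _ _ Ht3); exact: pair_double_bracket.
have nzN M : lagrangian_complement (double_pair g) L M ->
    obstruction_class (double_pair g) dbr L M != 0.
  move=> lagM; apply: contra_neq nzH => ob0; rewrite -(mv3_eval3 F6 Ht3).
  exact: (obstruction_class_eq0 F6 lie_br idI swap12 swap23 scal3 dbr1 pair_dbr lagM ob0).
split=> [||[M [dirM LM]]] //.
  exact: (dirac_ideal_double lie_br idI swap23 scal3 dbr1 pair_dbr).
(* A Dirac complement is in particular a lagrangian one, so its class would be both nonzero and the
   class of 0. *)
have /eqP[] := nzN M (conj dirM.1 LM).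
by rewrite /obstruction_class dirac_complement_N_compl // /cohomology_class !linear0.
Qed.
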